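(* There does not exist any homogeneous minimal Lagrangian immersion $f:\mathbb{D}\to\mathbb{C}P^2$, where $\mathbb{D}$ is the unit disk in $\mathbb{C}$.
   Context: $\mathbb{C}P^2$ carries the Fubini–Study metric. For a (conformal) minimal Lagrangian immersion $f:M\to\mathbb{C}P^2$ of a Riemann surface $M$, let $\Gamma^f_M$ be the group of all $\gamma\in\mathrm{Aut}(M)$ (biholomorphic automorphisms) for which there exists $R\in SU(3)$ with $f(\gamma\cdot z)=R\cdot f(z)$ for all $z\in M$. The immersion $f$ is homogeneous if $\Gamma^f_M$ acts transitively on $M$. *)

(* Defs.v *)
From Stdlib Require Import Reals Lia Lra.
From Coquelicot Require Export Coquelicot.
Open Scope R_scope.

Definition C3 : Type := @matrix C 3 1.
Definition C3_zero : C3 := mk_matrix 3 1 (fun _ _ => RtoC 0).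
Definition C3_scal (c : C) (v : C3) : C3 :=
  mk_matrix 3 1 (fun i j => (c * coeff_mat (RtoC 0) v i j)%C).

Record CP2 : Type := mkCP2 {
  line :> C3 -> Prop;
  line_spec : exists v : C3,
    v <> C3_zero /\ forall u : C3, line u <-> exists c : C, u = C3_scal c v
}.

Definition conj_transpose (A : @matrix C 3 3) : @matrix C 3 3 :=
  mk_matrix 3 3 (fun i j => Cconj (coeff_mat (RtoC 0) A j i)).

Definition det3 (A : @matrix C 3 3) : C :=
  let a := coeff_mat (RtoC 0) A in
  (a 0%nat 0%nat * (a 1%nat 1%nat * a 2%nat 2%nat - a 1%nat 2%nat * a 2%nat 1%nat)
   - a 0%nat 1%nat * (a 1%nat 0%nat * a 2%nat 2%nat - a 1%nat 2%nat * a 2%nat 0%nat)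
   + a 0%nat 2%nat * (a 1%nat 0%nat * a 2%nat 1%nat - a 1%nat 1%nat * a 2%nat 0%nat))%C.

Record SU3 : Type := mkSU3 {
  SU3_mat :> @matrix C 3 3;
  SU3_unitary : Mmult (T := C_Ring) (conj_transpose SU3_mat) SU3_mat
                = Mone (T := C_Ring);
  SU3_det : det3 SU3_mat = RtoC 1
}.

Definition SU3_apply (A : SU3) (v : C3) : C3 :=
  Mmult (T := C_Ring) (SU3_mat A) v.

Lemma C3_ext (u v : C3) :
  (forall i, (i < 3)%nat -> coeff_mat (RtoC 0) u i 0 = coeff_mat (RtoC 0) v i 0) ->
  u = v.
Proof.
intros H; apply (coeff_mat_ext_aux (RtoC 0) (RtoC 0)).
intros i j Hi Hj; replace j with 0%nat by lia; auto.
Qed.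

Lemma Mmult_C3_scal (A : @matrix C 3 3) (c : C) (v : C3) :
  Mmult (T := C_Ring) A (C3_scal c v)
  = C3_scal c (Mmult (T := C_Ring) A v).
Proof.
apply C3_ext; intros i Hi.
unfold C3_scal at 2; rewrite coeff_mat_bij by lia.
unfold Mmult; rewrite !coeff_mat_bij by lia.
simpl pred; rewrite !sum_Sn, !sum_O; unfold C3_scal.
change (@zero C_Ring) with (RtoC 0).
rewrite !coeff_mat_bij by lia.
change (@plus C_Ring) with Cplus; change (@mult C_Ring) with Cmult.
rewrite !Cmult_plus_distr_l, !Cmult_assoc, !(Cmult_comm c); reflexivity.
Qed.

Lemma C3_scal_0 (v : C3) : C3_scal (RtoC 0) v = C3_zero.
Proof.
apply C3_ext; intros i Hi.
unfold C3_scal, C3_zero; rewrite !coeff_mat_bij by lia; ring.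
Qed.

Lemma SU3_apply_nonzero (A : SU3) (v : C3) :
  v <> C3_zero -> SU3_apply A v <> C3_zero.
Proof.
intros Hv H; apply Hv.
rewrite <- (Mmult_one_l (T := C_Ring) v), <- (SU3_unitary A), <- Mmult_assoc.
change (Mmult (T := C_Ring) (SU3_mat A) v) with (SU3_apply A v); rewrite H.
rewrite <- (C3_scal_0 C3_zero), Mmult_C3_scal, !C3_scal_0; reflexivity.
Qed.

Lemma SU3_act_spec (A : SU3) (p : CP2) :
  exists v : C3, v <> C3_zero /\
    forall u : C3, (exists u0, p u0 /\ u = SU3_apply A u0)
                   <-> exists c : C, u = C3_scal c v.
Proof.
destruct (line_spec p) as [v [Hv Hp]].
exists (SU3_apply A v); split; [now apply SU3_apply_nonzero|].
intros u; split.
- intros [u0 [Hu0 ->]]; apply Hp in Hu0; destruct Hu0 as [c ->].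
  exists c; apply Mmult_C3_scal.
- intros [c ->]; exists (C3_scal c v); split.
  + apply Hp; now exists c.
  + symmetry; apply Mmult_C3_scal.
Qed.

Definition SU3_act (A : SU3) (p : CP2) : CP2 :=
  mkCP2 (fun u => exists u0, p u0 /\ u = SU3_apply A u0) (SU3_act_spec A p).

Definition C2 : Type := (C * C)%type.

Inductive chart : Type := chart0 | chart1 | chart2.

Definition homogeneous_coords (i : chart) (w : C2) : C3 :=
  let '(a, b, c) :=
    match i with
    | chart0 => (RtoC 1, fst w, snd w)
    | chart1 => (fst w, RtoC 1, snd w)
    | chart2 => (fst w, snd w, RtoC 1)
    end in
  mk_matrix 3 1 (fun k _ => match k with 0%nat => a | 1%nat => b | _ => c end).

Lemma homogeneous_coords_spec (i : chart) (w : C2) :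
  exists v : C3, v <> C3_zero /\
    forall u : C3, (exists c, u = C3_scal c (homogeneous_coords i w))
                   <-> exists c : C, u = C3_scal c v.
Proof.
exists (homogeneous_coords i w); split; [|tauto].
intros H.
assert (E : forall k, coeff_mat (RtoC 0) (homogeneous_coords i w) k 0
                      = coeff_mat (RtoC 0) C3_zero k 0) by (now rewrite H).
destruct i; [specialize (E 0%nat)|specialize (E 1%nat)|specialize (E 2%nat)];
  injection E; lra.
Qed.

(* The inverse of the affine chart [i]: it maps [w] to [1 : w1 : w2],
   [w1 : 1 : w2] or [w1 : w2 : 1]. *)
Definition affine_point (i : chart) (w : C2) : CP2 :=
  mkCP2 (fun u => exists c, u = C3_scal c (homogeneous_coords i w))
        (homogeneous_coords_spec i w).

Definition herm (u v : C2) : C :=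
  (fst u * Cconj (fst v) + snd u * Cconj (snd v))%C.

(* The real part of
     ((1 + |p|^2) <u, v> - <u, p> <p, v>) / (1 + |p|^2)^2,
   i.e. the metric with Kaehler potential log (1 + |p|^2), normalized to have
   holomorphic sectional curvature 4. By symmetry the expression is the same
   in the three charts. *)
Definition FS (p u v : C2) : R :=
  Re ((1 + herm p p) * herm u v - herm u p * herm p v)%C
  / (1 + Re (herm p p)) ^ 2.

Definition mul_i (u : C2) : C2 := ((Ci * fst u)%C, (Ci * snd u)%C).

Definition kaehler_form (p u v : C2) : R := FS p (mul_i u) v.

Definition dir_derive (phi : C2 -> R) (p v : C2) : R :=
  Derive (fun t : R => phi ((fst p + t * fst v)%C, (snd p + t * snd v)%C)) 0.

(* Christoffel symbols of the first kind: by Koszul's formula this is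
   FS p (nabla_u V) n, where nabla is the Levi-Civita connection and V is the
   vector field that is constantly v in the chart. *)
Definition christoffel (p u v n : C2) : R :=
  (dir_derive (fun q => FS q v n) p u
   + dir_derive (fun q => FS q u n) p v
   - dir_derive (fun q => FS q u v) p n) / 2.

Definition smooth_at (h : C -> R) (z : C) : Prop :=
  forall n : nat, ex_diff_n (fun x y => h (x, y)) n (fst z) (snd z).

Definition smooth2_at (w : C -> C2) (z : C) : Prop :=
  smooth_at (fun u => Re (fst (w u))) z /\ smooth_at (fun u => Im (fst (w u))) z /\
  smooth_at (fun u => Re (snd (w u))) z /\ smooth_at (fun u => Im (snd (w u))) z.

Definition partial_x (h : C -> R) (z : C) : R :=
  Derive (fun t => h (t, snd z)) (fst z).
Definition partial_y (h : C -> R) (z : C) : R :=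
  Derive (fun t => h (fst z, t)) (snd z).

Definition componentwise (d : (C -> R) -> C -> R) (w : C -> C2) (z : C) : C2 :=
  ((d (fun u => Re (fst (w u))) z, d (fun u => Im (fst (w u))) z),
   (d (fun u => Re (snd (w u))) z, d (fun u => Im (snd (w u))) z)).

Definition dx : (C -> C2) -> C -> C2 := componentwise partial_x.
Definition dy : (C -> C2) -> C -> C2 := componentwise partial_y.

(* Below, U is an open subset of C, with coordinate z = x + i y. A map U -> CP2
   is represented by a function on C whose values outside U are irrelevant. *)

(* Near z, the map f is the smooth function w in the affine chart i. *)
Definition chart_expression (f : C -> CP2) (z : C) (i : chart) (w : C -> C2) : Prop :=
  locally (T := C_UniformSpace) z
    (fun u => smooth2_at w u /\ f u = affine_point i (w u)).

Definition smooth_map (U : C -> Prop) (f : C -> CP2) : Prop :=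
  forall z, U z -> exists i w, chart_expression f z i w.

Definition immersive (U : C -> Prop) (f : C -> CP2) : Prop :=
  forall z i w, U z -> chart_expression f z i w ->
  forall a b : R,
    (RtoC a * fst (dx w z) + RtoC b * fst (dy w z))%C = RtoC 0 ->
    (RtoC a * snd (dx w z) + RtoC b * snd (dy w z))%C = RtoC 0 ->
    a = 0 /\ b = 0.

Definition conformal (U : C -> Prop) (f : C -> CP2) : Prop :=
  forall z i w, U z -> chart_expression f z i w ->
    FS (w z) (dx w z) (dx w z) = FS (w z) (dy w z) (dy w z) /\
    FS (w z) (dx w z) (dy w z) = 0.

Definition lagrangian (U : C -> Prop) (f : C -> CP2) : Prop :=
  forall z i w, U z -> chart_expression f z i w ->
    kaehler_form (w z) (dx w z) (dy w z) = 0.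

Definition normal_vector (w : C -> C2) (z : C) (N : C2) : Prop :=
  FS (w z) (dx w z) N = 0 /\ FS (w z) (dy w z) N = 0.

(* For N normal and d1, d2 among dx, dy: the inner product of N with the second
   fundamental form II(d1, d2), i.e. with the covariant derivative along d1 of
   the tangent field d2 w. *)
Definition second_fundamental_form
    (d1 d2 : (C -> C2) -> C -> C2) (w : C -> C2) (z : C) (N : C2) : R :=
  FS (w z) (d1 (d2 w) z) N + christoffel (w z) (d1 w z) (d2 w z) N.

(* The inner product of N with the mean curvature vector, which is half the
   trace of II with respect to the induced metric. *)
Definition mean_curvature (w : C -> C2) (z : C) (N : C2) : R :=
  let E := FS (w z) (dx w z) (dx w z) in
  let F := FS (w z) (dx w z) (dy w z) in
  let G := FS (w z) (dy w z) (dy w z) in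
  (G * second_fundamental_form dx dx w z N
   - 2 * F * second_fundamental_form dx dy w z N
   + E * second_fundamental_form dy dy w z N) / (2 * (E * G - F ^ 2)).

Definition minimal (U : C -> Prop) (f : C -> CP2) : Prop :=
  forall z i w, U z -> chart_expression f z i w ->
  forall N : C2, normal_vector w z N -> mean_curvature w z N = 0.

Definition conformal_minimal_lagrangian_immersion
    (U : C -> Prop) (f : C -> CP2) : Prop :=
  smooth_map U f /\ immersive U f /\ conformal U f /\ lagrangian U f /\ minimal U f.

Definition holomorphic_on (U : C -> Prop) (g : C -> C) : Prop :=
  forall z, U z -> @ex_derive C_AbsRing C_NormedModule g z.

Definition automorphism (U : C -> Prop) (g : C -> C) : Prop :=
  (forall z, U z -> U (g z)) /\ holomorphic_on U g /\
  exists h : C -> C,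
    (forall z, U z -> U (h z)) /\ holomorphic_on U h /\
    (forall z, U z -> h (g z) = z) /\ (forall z, U z -> g (h z) = z).

Definition symmetry_group (U : C -> Prop) (f : C -> CP2) (g : C -> C) : Prop :=
  automorphism U g /\
  exists A : SU3, forall z, U z -> f (g z) = SU3_act A (f z).

Definition homogeneous (U : C -> Prop) (f : C -> CP2) : Prop :=
  forall z1 z2, U z1 -> U z2 -> exists g, symmetry_group U f g /\ g z1 = z2.

Definition unit_disk (z : C) : Prop := Cmod z < 1.

(* Main.v *)
From Stdlib Require Import Reals Ranalysis5 Lra Lia List Classical.
Require Import Defs.
Open Scope R_scope.

(** Since SU(3) is compact and the symmetries act transitively, there are symmetries [a], [b]
    with [a 0] and [b 0] distinct but arbitrarily close, whose matrices are almost equal; then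
    [n = a^-1 b] is a symmetry that moves [0] a little, and every conjugate [g^-1 n g] almost
    fixes [f 0].  As [f] is an immersion at [0], no conjugate can move [0] by exactly a fixed
    small hyperbolic radius [r]; by the Schwarz-Pick lemma and transitivity this says that the
    hyperbolic displacement of [n] never takes the value [r], so by connectedness it is less
    than [r] on the whole disk.  Hence [n z - z] tends to [0] at the unit circle, and the mean
    value property gives [n 0 = 0], contradicting [a 0 <> b 0].

    The Schwarz lemma is needed for functions that are merely complex differentiable, so
    Goursat's argument is unavoidable; it is applied in polar coordinates, where it directly
    yields the mean value property, with an exceptional point allowed. *)

(** * Goursat's theorem for closed forms on rectangles *)

(** Everything rests on uniformity in p = g 0. If M is the matrix of g and q = g^-1 (n p), then A M
    f(q) = B M f(0); as M preserves norms, closeness of A and B brings f(q) near f(0) by an amount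
    independent of M. Displacement is measured by the pseudo-hyperbolic distance
    [Cmod (mobius p (n p))], which equals |q| by Schwarz-Pick for both g and its inverse. The
    immersion separates f(q) from f(0) only for q in a small disc around 0; far from 0, f may well
    return close to f(0). Hence the displacement cannot be bounded directly: one value r is
    excluded, and connectedness turns this gap into a bound. The exceptional point in the mean value
    property serves the quotient h(z)/z of the Schwarz lemma, whose filled-in value at 0 makes it
    continuous there, while its differentiability at 0 is not yet known. *)

Lemma continuity_2d_pt_fst (f : R -> R -> R) (x y : R) :
  continuity_2d_pt f x y -> continuous (fun u => f u y) x.
Proof.
intros H; apply continuity_pt_filterlim.
apply continuity_pt_locally; intros eps.
destruct (H eps) as [d Hd]; exists d; intros u Hu.
apply Hd; [exact Hu|rewrite Rminus_diag, Rabs_R0; apply cond_pos].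
Qed.

Lemma continuity_2d_pt_snd (f : R -> R -> R) (x y : R) :
  continuity_2d_pt f x y -> continuous (fun v => f x v) y.
Proof.
intros H; apply continuity_pt_filterlim.
apply continuity_pt_locally; intros eps.
destruct (H eps) as [d Hd]; exists d; intros u Hu.
apply Hd; [rewrite Rminus_diag, Rabs_R0; apply cond_pos|exact Hu].
Qed.

(** The line integral of P dx + Q dy, counterclockwise around the boundary of [a,b] x [c,d]. *)
Definition circulation (P Q : R -> R -> R) (a b c d : R) : R :=
  RInt (fun x => P x c) a b + RInt (fun y => Q b y) c d
  - RInt (fun x => P x d) a b - RInt (fun y => Q a y) c d.

(** The shared [m] expresses closedness: the y-derivative of P is the x-derivative of Q. Nothing is
    said about continuity of the derivatives, so Green's formula is out of reach. *)
Definition closed_form_at (P Q : R -> R -> R) (x y : R) : Prop :=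
  exists p m q, differentiable_pt_lim P x y p m /\ differentiable_pt_lim Q x y m q.

Lemma ex_RInt_horizontal (P Q : R -> R -> R) (a b c d x1 x2 y : R) :
  (forall x y, a <= x <= b -> c <= y <= d -> closed_form_at P Q x y) ->
  a <= x1 <= b -> a <= x2 <= b -> c <= y <= d -> ex_RInt (fun x => P x y) x1 x2.
Proof.
intros closed_form H1 H2 Hy; apply (@ex_RInt_continuous R_CompleteNormedModule); intros z Hz.
apply continuity_2d_pt_fst, differentiable_continuity_pt.
destruct (closed_form z y) as (p & m & q & HP & _); [|exact Hy|now exists p, m].
revert Hz; unfold Rmin, Rmax; destruct (Rle_dec x1 x2); lra.
Qed.

Lemma ex_RInt_vertical (P Q : R -> R -> R) (a b c d x y1 y2 : R) :
  (forall x y, a <= x <= b -> c <= y <= d -> closed_form_at P Q x y) ->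
  a <= x <= b -> c <= y1 <= d -> c <= y2 <= d -> ex_RInt (fun y => Q x y) y1 y2.
Proof.
intros closed_form Hx H1 H2; apply (@ex_RInt_continuous R_CompleteNormedModule); intros z Hz.
apply continuity_2d_pt_snd, differentiable_continuity_pt.
destruct (closed_form x z) as (p & m & q & _ & HQ); [exact Hx| |now exists m, q].
revert Hz; unfold Rmin, Rmax; destruct (Rle_dec y1 y2); lra.
Qed.

Lemma circulation_split (P Q : R -> R -> R) (a b c d x1 x2 x3 y1 y2 y3 : R) :
  (forall x y, a <= x <= b -> c <= y <= d -> closed_form_at P Q x y) ->
  a <= x1 <= x2 -> x2 <= x3 <= b -> c <= y1 <= y2 -> y2 <= y3 <= d ->
  circulation P Q x1 x3 y1 y3 =
  circulation P Q x1 x2 y1 y2 + circulation P Q x2 x3 y1 y2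
  + circulation P Q x1 x2 y2 y3 + circulation P Q x2 x3 y2 y3.
Proof.
intros closed_form H1 H2 H3 H4; unfold circulation.
assert (EP : forall y, c <= y <= d ->
  RInt (fun x => P x y) x1 x3 = RInt (fun x => P x y) x1 x2 + RInt (fun x => P x y) x2 x3).
{ intros y Hy; symmetry.
  apply (RInt_Chasles (fun x => P x y)); eapply ex_RInt_horizontal; try exact closed_form; lra. }
assert (EQ : forall x, a <= x <= b ->
  RInt (fun y => Q x y) y1 y3 = RInt (fun y => Q x y) y1 y2 + RInt (fun y => Q x y) y2 y3).
{ intros x Hx; symmetry.
  apply (RInt_Chasles (fun y => Q x y)); eapply ex_RInt_vertical; try exact closed_form; lra. }
rewrite !EP, !EQ by lra; ring.
Qed.

Lemma RInt_near_const (f : R -> R) (a b k e : R) :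
  a <= b -> ex_RInt f a b -> (forall x, a <= x <= b -> Rabs (f x - k) <= e) ->
  Rabs (RInt f a b - k * (b - a)) <= e * (b - a).
Proof.
intros Hab Hf He.
assert (Hle : RInt (fun _ => k - e) a b <= RInt f a b <= RInt (fun _ => k + e) a b).
{ split; apply RInt_le; trivial; try apply ex_RInt_const;
    intros x Hx; specialize (He x ltac:(lra)); apply Rabs_le_between in He; lra. }
rewrite !RInt_const in Hle; unfold scal in Hle; simpl in Hle; unfold mult in Hle; simpl in Hle.
apply Rabs_le_between; nra.
Qed.

(** The linear part of a closed form has zero circulation: its P and Q contributions are opposite
    multiples of m times the area. What is left is an error of at most e * D on each of four sides
    of length at most D. *)
Lemma circulation_small (P Q : R -> R -> R) (u v p m q e : R) (x1 x2 y1 y2 D : R) :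
  (forall x y, x1 <= x <= x2 -> y1 <= y <= y2 -> closed_form_at P Q x y) ->
  x1 <= u <= x2 -> y1 <= v <= y2 -> 0 <= e ->
  x2 - x1 <= D -> y2 - y1 <= D ->
  (forall x y, x1 <= x <= x2 -> y1 <= y <= y2 ->
     Rabs (P x y - P u v - (p * (x - u) + m * (y - v))) <= e * Rmax (Rabs (x - u)) (Rabs (y - v))
  /\ Rabs (Q x y - Q u v - (m * (x - u) + q * (y - v))) <= e * Rmax (Rabs (x - u)) (Rabs (y - v))) ->
  Rabs (circulation P Q x1 x2 y1 y2) <= 4 * e * D ^ 2.
Proof.
intros Hcf Hu Hv He HD1 HD2 Herr.
assert (Hmax : forall x y, x1 <= x <= x2 -> y1 <= y <= y2 ->
  e * Rmax (Rabs (x - u)) (Rabs (y - v)) <= e * D).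
{ intros x y Hx Hy; apply Rmult_le_compat_l; trivial.
  apply Rmax_lub; apply Rabs_le_between; lra. }
assert (HP : Rabs (RInt (fun x => P x y1 - P x y2) x1 x2 - m * (y1 - y2) * (x2 - x1))
             <= 2 * e * D * (x2 - x1)).
{ apply RInt_near_const; [lra| |].
  - apply (@ex_RInt_minus R_NormedModule); eapply ex_RInt_horizontal; try exact Hcf; lra.
  - intros x Hx.
    destruct (Herr x y1) as [E1 _]; try lra; destruct (Herr x y2) as [E2 _]; try lra.
    generalize (Hmax x y1 ltac:(lra) ltac:(lra)) (Hmax x y2 ltac:(lra) ltac:(lra)).
    apply Rabs_le_between in E1; apply Rabs_le_between in E2; intros.
    apply Rabs_le_between; lra. }
assert (HQ : Rabs (RInt (fun y => Q x2 y - Q x1 y) y1 y2 - m * (x2 - x1) * (y2 - y1))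
             <= 2 * e * D * (y2 - y1)).
{ apply RInt_near_const; [lra| |].
  - apply (@ex_RInt_minus R_NormedModule); eapply ex_RInt_vertical; try exact Hcf; lra.
  - intros y Hy.
    destruct (Herr x1 y) as [_ E1]; try lra; destruct (Herr x2 y) as [_ E2]; try lra.
    generalize (Hmax x1 y ltac:(lra) ltac:(lra)) (Hmax x2 y ltac:(lra) ltac:(lra)).
    apply Rabs_le_between in E1; apply Rabs_le_between in E2; intros.
    apply Rabs_le_between; lra. }
rewrite (RInt_minus (fun x => P x y1) (fun x => P x y2)) in HP
  by (eapply ex_RInt_horizontal; try exact Hcf; lra).
rewrite (RInt_minus (fun y => Q x2 y) (fun y => Q x1 y)) in HQ
  by (eapply ex_RInt_vertical; try exact Hcf; lra).
unfold minus, plus, opp in HP, HQ; simpl in HP, HQ; unfold circulation.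
apply Rabs_le_between in HP; apply Rabs_le_between in HQ.
assert (0 <= e * D) by (apply Rmult_le_pos; lra).
assert (2 * e * D * (x2 - x1) <= 2 * e * D * D) by nra.
assert (2 * e * D * (y2 - y1) <= 2 * e * D * D) by nra.
apply Rabs_le_between; nra.
Qed.

(* Goursat's bisection: the corner of a quarter carrying at least a quarter of the circulation. *)
Definition heavy_quarter (P Q : R -> R -> R) (w h : R) (z : R * R) : R * R :=
  let J x y := Rabs (circulation P Q x (x + w / 2) y (y + h / 2)) in
  let t := Rabs (circulation P Q (fst z) (fst z + w) (snd z) (snd z + h)) / 4 in
  let (x, y) := z in
  if Rle_dec t (J x y) then (x, y)
  else if Rle_dec t (J (x + w / 2) y) then (x + w / 2, y)
  else if Rle_dec t (J x (y + h / 2)) then (x, y + h / 2)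
  else (x + w / 2, y + h / 2).

Fixpoint bisection (P Q : R -> R -> R) (a c w h : R) (n : nat) : R * R :=
  match n with
  | O => (a, c)
  | S n => heavy_quarter P Q (w / 2 ^ n) (h / 2 ^ n) (bisection P Q a c w h n)
  end.

(** Left ends increase, right ends decrease and the gap tends to 0, so these are adjacent sequences
    with a common limit. *)
Lemma nested_intervals (x : nat -> R) (w : R) :
  0 <= w -> (forall n, x (S n) = x n \/ x (S n) = x n + w / 2 ^ S n) ->
  exists u, forall n, x n <= u <= x n + w / 2 ^ n.
Proof.
intros Hw Hx.
assert (Hpos : forall n, 0 <= w / 2 ^ S n) by
 (intros n; apply Rle_mult_inv_pos; trivial; apply pow_lt; lra).
assert (Hhalf : forall n, w / 2 ^ n = 2 * (w / 2 ^ S n)).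
{ intros n; simpl; field; apply pow_nonzero; lra. }
assert (Hincr : forall n, x n <= x (S n)).
{ intros n; specialize (Hpos n); destruct (Hx n) as [->| ->]; lra. }
assert (Hdecr : forall n, x (S n) + w / 2 ^ S n <= x n + w / 2 ^ n).
{ intros n; specialize (Hpos n); rewrite (Hhalf n); destruct (Hx n) as [->| ->]; lra. }
assert (Hlim : is_lim_seq (fun n => x n + w / 2 ^ n - x n) 0).
{ apply is_lim_seq_ext with (fun n => w * (/ 2) ^ n).
  { intros n; rewrite pow_inv; unfold Rdiv; ring. }
  replace (Finite 0) with (Rbar_mult w 0) by (simpl; f_equal; ring).
  apply is_lim_seq_scal_l, is_lim_seq_geom; rewrite Rabs_pos_eq; lra. }
destruct (ex_lim_seq_adj _ _ Hincr Hdecr Hlim) as ([u Hu] & [v Hv] & E).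
apply is_lim_seq_unique in Hu as Eu; apply is_lim_seq_unique in Hv as Ev.
rewrite Eu, Ev in E; injection E as E; subst v.
exists u; intros n; split.
- exact (is_lim_seq_incr_compare _ _ Hu Hincr n).
- exact (is_lim_seq_decr_compare _ _ Hv Hdecr n).
Qed.

Theorem goursat_rectangle (P Q : R -> R -> R) (a b c d : R) :
  a <= b -> c <= d ->
  (forall x y, a <= x <= b -> c <= y <= d -> closed_form_at P Q x y) ->
  circulation P Q a b c d = 0.
Proof.
intros Hab Hcd Hcf.
set (w := b - a); set (h := d - c).
set (z := bisection P Q a c w h).
assert (Hpow : forall n, 0 < 2 ^ n) by (intros n; apply pow_lt; lra).
assert (Hwn : forall n, 0 <= w / 2 ^ n) by
 (intros n; apply Rle_mult_inv_pos; trivial; unfold w; lra).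
assert (Hhn : forall n, 0 <= h / 2 ^ n) by
 (intros n; apply Rle_mult_inv_pos; trivial; unfold h; lra).
assert (Hhalf : forall t n, t / 2 ^ n / 2 = t / 2 ^ S n).
{ intros t n; simpl; field; apply pow_nonzero; lra. }
assert (Hdouble : forall t n, t / 2 ^ n = t / 2 ^ S n + t / 2 ^ S n).
{ intros t n; simpl; field; apply pow_nonzero; lra. }
assert (Hz : forall n,
  (fst (z (S n)) = fst (z n) \/ fst (z (S n)) = fst (z n) + w / 2 ^ S n) /\
  (snd (z (S n)) = snd (z n) \/ snd (z (S n)) = snd (z n) + h / 2 ^ S n)).
{ intros n; unfold z; simpl bisection; unfold heavy_quarter; rewrite !Hhalf.
  destruct (bisection P Q a c w h n) as [x y].
  repeat destruct Rle_dec; simpl fst; simpl snd; auto. }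
destruct (nested_intervals (fun n => fst (z n)) w) as [u Hu];
  [unfold w; lra|intros n; apply Hz|].
destruct (nested_intervals (fun n => snd (z n)) h) as [v Hv];
  [unfold h; lra|intros n; apply Hz|].
assert (Hin : forall n, a <= fst (z n) /\ fst (z n) + w / 2 ^ n <= b /\
                        c <= snd (z n) /\ snd (z n) + h / 2 ^ n <= d).
{ intros n; induction n as [|n IH].
  - unfold z, w, h; simpl; lra.
  - destruct (Hz n) as [H1 H2].
    generalize (Hwn (S n)) (Hhn (S n)).
    rewrite (Hdouble w n), (Hdouble h n) in IH.
    destruct H1 as [->| ->]; destruct H2 as [->| ->]; lra. }
assert (Hheavy : forall n,
  Rabs (circulation P Q a b c d) <=
  4 ^ n * Rabs (circulation P Q (fst (z n)) (fst (z n) + w / 2 ^ n)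
                                (snd (z n)) (snd (z n) + h / 2 ^ n))).
{ intros n; induction n as [|n IH].
  - unfold z, w, h; simpl.
    replace (a + (b - a) / 1) with b by field; replace (c + (d - c) / 1) with d by field; lra.
  - apply Rle_trans with (1 := IH).
    assert (0 < 4 ^ n) by (apply pow_lt; lra).
    simpl pow at 4; rewrite (Rmult_comm 4), Rmult_assoc.
    apply Rmult_le_compat_l; [lra|].
    destruct (Hin n) as (I1 & I2 & I3 & I4).
    generalize (Hwn (S n)) (Hhn (S n)); intros W W'.
    rewrite (Hdouble w n) in I2; rewrite (Hdouble h n) in I4.
    assert (S4 := circulation_split P Q a b c d
      (fst (z n)) (fst (z n) + w / 2 ^ S n) (fst (z n) + w / 2 ^ n)
      (snd (z n)) (snd (z n) + h / 2 ^ S n) (snd (z n) + h / 2 ^ n) Hcf).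
    rewrite (Hdouble w n), (Hdouble h n) in S4.
    specialize (S4 ltac:(lra) ltac:(lra) ltac:(lra) ltac:(lra)).
    unfold z at 5 6 7 8; simpl bisection; unfold heavy_quarter.
    fold z; fold (z n) in *; rewrite !Hhalf.
    rewrite (Hdouble w n), (Hdouble h n).
    rewrite <- !Rplus_assoc in S4.
    destruct (z n) as [x y]; simpl fst in *; simpl snd in *.
    rewrite <- !Rplus_assoc.
    change (2 * 2 ^ n) with (2 ^ S n).
    match type of S4 with ?A = ?B1 + ?B2 + ?B3 + ?B4 =>
      assert (Rabs A <= Rabs B1 + Rabs B2 + Rabs B3 + Rabs B4) end.
    { rewrite S4; eapply Rle_trans; [apply Rabs_triang|]; apply Rplus_le_compat_r.
      eapply Rle_trans; [apply Rabs_triang|]; apply Rplus_le_compat_r; apply Rabs_triang. }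
    (* [heavy_quarter] does not test its last case; there the three failed tests and the triangle
       inequality force the fourth quarter to be heavy. *)
    repeat destruct Rle_dec; simpl fst; simpl snd; change (2 * 2 ^ n) with (2 ^ S n); lra. }
assert (H0 := Hin 0%nat); generalize (Hu 0%nat) (Hv 0%nat); intros Hu0 Hv0.
simpl in H0, Hu0, Hv0.
destruct (Hcf u v) as (p & m & q & HP & HQ); [lra|lra|].
destruct (Req_dec (circulation P Q a b c d) 0) as [E|E]; trivial; exfalso.
apply Rabs_pos_lt in E; set (I := Rabs (circulation P Q a b c d)) in *.
set (D := w + h).
assert (HD : 0 <= D) by (unfold D, w, h; lra).
(* With this e, the final bound 4 e D^2 is at most I / 2, contradicting I > 0; the + 1 covers D =
   0. *)
assert (He : 0 < I / (8 * (D ^ 2 + 1))).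
{ apply Rdiv_lt_0_compat; trivial; nra. }
set (e := mkposreal _ He).
destruct (HP e) as [d1 Hd1]; destruct (HQ e) as [d2 Hd2].
assert (Hd : 0 < Rmin d1 d2) by (apply Rmin_glb_lt; apply cond_pos).
assert (Hn : exists n, D / 2 ^ n < Rmin d1 d2).
{ assert (L : is_lim_seq (fun n => D * (/ 2) ^ n) 0).
  { replace (Finite 0) with (Rbar_mult D 0) by (simpl; f_equal; ring).
    apply is_lim_seq_scal_l, is_lim_seq_geom; rewrite Rabs_pos_eq; lra. }
  apply is_lim_seq_spec in L; destruct (L (mkposreal _ Hd)) as [n Hn].
  exists n; specialize (Hn n (le_n n)); simpl in Hn.
  rewrite Rminus_0_r, pow_inv in Hn; apply Rle_lt_trans with (1 := Rle_abs _); exact Hn. }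
destruct Hn as [n Hn].
assert (HwD : w / 2 ^ n <= D / 2 ^ n).
{ apply Rmult_le_compat_r; [left; apply Rinv_0_lt_compat; trivial|unfold D, w, h; lra]. }
assert (HhD : h / 2 ^ n <= D / 2 ^ n).
{ apply Rmult_le_compat_r; [left; apply Rinv_0_lt_compat; trivial|unfold D, w, h; lra]. }
generalize (Rmin_l d1 d2) (Rmin_r d1 d2); intros M1 M2.
specialize (Hin n); specialize (Hu n); specialize (Hv n); specialize (Hheavy n).
simpl in Hu, Hv.
assert (Hsmall := circulation_small P Q u v p m q e
  (fst (z n)) (fst (z n) + w / 2 ^ n) (snd (z n)) (snd (z n) + h / 2 ^ n) (D / 2 ^ n)).
(* The factor 4^n lost in n bisections is exactly compensated by the squared side (D / 2^n)^2. *)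
assert (Hc4 : 4 ^ n = 2 ^ n * 2 ^ n) by (rewrite <- Rpow_mult_distr; f_equal; ring).
assert (HI : I <= 4 ^ n * (4 * e * (D / 2 ^ n) ^ 2)).
{ eapply Rle_trans; [exact Hheavy|].
  apply Rmult_le_compat_l; [apply pow_le; lra|].
  apply Hsmall; try lra.
  - intros x y Hx Hy; apply Hcf; lra.
  - left; apply cond_pos.
  - intros x y Hx Hy; split; [apply Hd1|apply Hd2]; apply Rabs_lt_between; lra. }
replace (4 ^ n * (4 * e * (D / 2 ^ n) ^ 2)) with (4 * e * D ^ 2) in HI
  by (rewrite Hc4; field; apply pow_nonzero; lra).
change (pos e) with (I / (8 * (D ^ 2 + 1))) in HI.
replace (4 * (I / (8 * (D ^ 2 + 1))) * D ^ 2) with (I / 2 * (D ^ 2 / (D ^ 2 + 1))) in HI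
  by (field; nra).
assert (D ^ 2 / (D ^ 2 + 1) <= 1).
{ apply Rle_div_l; nra. }
assert (I / 2 * (D ^ 2 / (D ^ 2 + 1)) <= I / 2 * 1) by (apply Rmult_le_compat_l; lra).
lra.
Qed.

(** * Complex differentiability *)

Definition ccontinuous (f : C -> C) (z : C) : Prop :=
  forall eps, 0 < eps -> exists d, 0 < d /\
    forall y, Cmod (y - z) < d -> Cmod (f y - f z) < eps.

Lemma ccontinuous_const (c z : C) : ccontinuous (fun _ => c) z.
Proof.
intros eps He; exists 1; split; [lra|]; intros y _.
replace (c - c)%C with (RtoC 0) by ring; now rewrite Cmod_0.
Qed.

Lemma ccontinuous_id (z : C) : ccontinuous (fun y => y) z.
Proof. intros eps He; now exists eps. Qed.

Lemma ccontinuous_plus (f g : C -> C) (z : C) :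
  ccontinuous f z -> ccontinuous g z -> ccontinuous (fun y => f y + g y)%C z.
Proof.
intros Hf Hg eps He.
destruct (Hf (eps / 2)) as (d1 & Hd1 & H1); [lra|].
destruct (Hg (eps / 2)) as (d2 & Hd2 & H2); [lra|].
exists (Rmin d1 d2); split; [now apply Rmin_glb_lt|]; intros y Hy.
replace (f y + g y - (f z + g z))%C with ((f y - f z) + (g y - g z))%C by ring.
apply Rle_lt_trans with (1 := Cmod_triangle _ _).
generalize (H1 y (Rlt_le_trans _ _ _ Hy (Rmin_l _ _))).
generalize (H2 y (Rlt_le_trans _ _ _ Hy (Rmin_r _ _))); lra.
Qed.

Lemma ccontinuous_mult (f g : C -> C) (z : C) :
  ccontinuous f z -> ccontinuous g z -> ccontinuous (fun y => f y * g y)%C z.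
Proof.
intros Hf Hg eps He.
assert (Pf := Cmod_ge_0 (f z)); assert (Pg := Cmod_ge_0 (g z)).
set (M := Cmod (f z) + Cmod (g z) + 1).
set (e := Rmin 1 (eps / M)).
assert (HM : 0 < M) by (unfold M; lra).
assert (He' : 0 < e) by (apply Rmin_glb_lt; [lra|now apply Rdiv_lt_0_compat]).
assert (HeM : e * M <= eps).
{ replace eps with (eps / M * M) by (field; lra).
  apply Rmult_le_compat_r; [lra|apply Rmin_r]. }
assert (He1 : e <= 1) by apply Rmin_l.
destruct (Hf e He') as (d1 & Hd1 & H1); destruct (Hg e He') as (d2 & Hd2 & H2).
exists (Rmin d1 d2); split; [now apply Rmin_glb_lt|]; intros y Hy.
replace (f y * g y - f z * g z)%C
  with ((f y - f z) * (g y - g z) + (f y - f z) * g z + f z * (g y - g z))%C by ring.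
apply Rle_lt_trans with (1 := Cmod_triangle _ _).
apply Rle_lt_trans with (Cmod (f y - f z) * Cmod (g y - g z)
  + Cmod (f y - f z) * Cmod (g z) + Cmod (f z) * Cmod (g y - g z)).
{ rewrite <- !Cmod_mult; apply Rplus_le_compat_r, Cmod_triangle. }
assert (K1 := H1 y (Rlt_le_trans _ _ _ Hy (Rmin_l _ _))).
assert (K2 := H2 y (Rlt_le_trans _ _ _ Hy (Rmin_r _ _))).
assert (P1 := Cmod_ge_0 (f y - f z)); assert (P2 := Cmod_ge_0 (g y - g z)).
unfold M in HeM; nra.
Qed.

Lemma ccontinuous_comp (f g : C -> C) (z : C) :
  ccontinuous g z -> ccontinuous f (g z) -> ccontinuous (fun y => f (g y)) z.
Proof.
intros Hg Hf eps He.
destruct (Hf eps He) as (d1 & Hd1 & H1); destruct (Hg d1 Hd1) as (d2 & Hd2 & H2).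
exists d2; split; trivial; intros y Hy; now apply H1, H2.
Qed.

Lemma ccontinuous_inv (z : C) : z <> 0 -> ccontinuous Cinv z.
Proof.
intros Hz eps He; apply Cmod_gt_0 in Hz as Pz.
set (m := Cmod z) in *.
exists (Rmin (m / 2) (eps * (m * m) / 4)).
assert (P2 : 0 < m * m) by nra.
split; [apply Rmin_glb_lt; [lra|apply Rdiv_lt_0_compat; nra]|]; intros y Hy.
assert (K1 := Rlt_le_trans _ _ _ Hy (Rmin_l _ _)).
assert (K2 := Rlt_le_trans _ _ _ Hy (Rmin_r _ _)).
assert (Hmy : m / 2 < Cmod y).
{ generalize (Cmod_triangle y (z - y)); replace (y + (z - y))%C with z by ring.
  replace (z - y)%C with (- (y - z))%C by ring; rewrite Cmod_opp; fold m; lra. }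
assert (Hy0 : y <> 0) by (apply Cmod_gt_0; lra).
replace (/ y - / z)%C with (- (y - z) / (y * z))%C by (field; now split).
rewrite Cmod_div, Cmod_opp, Cmod_mult by (now apply Cmult_neq_0).
fold m; apply Rlt_div_l; [nra|].
assert (0 < eps * m) by nra; nra.
Qed.

(* Caratheodory's form of complex differentiability. *)
Definition cdiff (f : C -> C) (z : C) : Prop :=
  exists q, ccontinuous q z /\ forall y, (f y - f z = q y * (y - z))%C.

Definition is_cderive (f : C -> C) (z l : C) : Prop :=
  forall eps, 0 < eps -> exists d, 0 < d /\
    forall y, Cmod (y - z) < d -> Cmod (f y - f z - l * (y - z)) <= eps * Cmod (y - z).

Lemma cdiff_is_cderive (f : C -> C) (z : C) : cdiff f z -> exists l, is_cderive f z l.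
Proof.
intros (q & Hq & E); exists (q z); intros eps He.
destruct (Hq eps He) as (d & Hd & H); exists d; split; trivial; intros y Hy.
rewrite E; replace (q y * (y - z) - q z * (y - z))%C with ((q y - q z) * (y - z))%C by ring.
rewrite Cmod_mult; apply Rmult_le_compat_r; [apply Cmod_ge_0|left; now apply H].
Qed.

(** Besides giving Caratheodory's quotient, this supplies the continuity at 0 of h(z)/z in the
    Schwarz lemma. *)
Lemma is_cderive_quotient (f : C -> C) (z l : C) :
  is_cderive f z l ->
  ccontinuous (fun y => if Ceq_dec y z then l else ((f y - f z) / (y - z))%C) z.
Proof.
intros H eps He; destruct (H (eps / 2)) as (d & Hd & K); [lra|].
exists d; split; trivial; intros y Hy.
destruct (Ceq_dec z z) as [_|N]; [|now elim N].
destruct (Ceq_dec y z) as [_|N].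
- replace (l - l)%C with (RtoC 0) by ring; now rewrite Cmod_0.
- assert (N' : (y - z)%C <> 0).
  { intros E; apply N; replace y with (y - z + z)%C by ring; rewrite E; ring. }
  replace ((f y - f z) / (y - z) - l)%C with ((f y - f z - l * (y - z)) / (y - z))%C
    by (field; exact N').
  rewrite Cmod_div by exact N'; apply Cmod_gt_0 in N'.
  apply Rlt_div_l; [exact N'|]; specialize (K y Hy); nra.
Qed.

Lemma is_cderive_cdiff (f : C -> C) (z l : C) : is_cderive f z l -> cdiff f z.
Proof.
intros H; exists (fun y => if Ceq_dec y z then l else ((f y - f z) / (y - z))%C).
split; [now apply is_cderive_quotient|]; intros y.
destruct (Ceq_dec y z) as [->|N]; [ring|field].
intros E; apply N; replace y with (y - z + z)%C by ring; rewrite E; ring.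
Qed.

Lemma ex_derive_cdiff (f : C -> C) (z : C) :
  @ex_derive C_AbsRing C_NormedModule f z -> cdiff f z.
Proof.
intros [l [_ H]]; apply is_cderive_cdiff with l; intros eps He.
(* The identity function witnesses that [locally z] converges to z; the balls here are those of
   [Cmod]. *)
destruct (H z (fun P HP => HP) (mkposreal eps He)) as [d Hd].
exists d; split; [apply cond_pos|]; intros y Hy.
specialize (Hd y Hy).
change (Cmod (f y + - f z + - ((y + - z) * l)) <= eps * Cmod (y - z)) in Hd.
replace (f y - f z - l * (y - z))%C with (f y + - f z + - ((y + - z) * l))%C by ring.
exact Hd.
Qed.

Lemma cdiff_ccontinuous (f : C -> C) (z : C) : cdiff f z -> ccontinuous f z.
Proof.
intros (q & Hq & E).
assert (H : ccontinuous (fun y => f z + q y * (y - z))%C z).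
{ apply ccontinuous_plus; [apply ccontinuous_const|].
  apply ccontinuous_mult; [exact Hq|].
  apply ccontinuous_plus; [apply ccontinuous_id|apply ccontinuous_const]. }
intros eps He; destruct (H eps He) as (d & Hd & K); exists d; split; trivial; intros y Hy.
specialize (K y Hy); rewrite <- E in K.
replace (f y - f z)%C with (f z + (f y - f z) - (f z + q z * (z - z)))%C by ring; exact K.
Qed.

Lemma cdiff_const (c z : C) : cdiff (fun _ => c) z.
Proof.
exists (fun _ => RtoC 0); split; [apply ccontinuous_const|]; intros y; ring.
Qed.

Lemma cdiff_id (z : C) : cdiff (fun y => y) z.
Proof.
exists (fun _ => RtoC 1); split; [apply ccontinuous_const|]; intros y; ring.
Qed.

Lemma cdiff_plus (f g : C -> C) (z : C) :
  cdiff f z -> cdiff g z -> cdiff (fun y => f y + g y)%C z.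
Proof.
intros (q & Hq & E) (r & Hr & E'); exists (fun y => q y + r y)%C; split.
- now apply ccontinuous_plus.
- intros y; replace (f y + g y - (f z + g z))%C with ((f y - f z) + (g y - g z))%C by ring.
  rewrite E, E'; ring.
Qed.

Lemma cdiff_mult (f g : C -> C) (z : C) :
  cdiff f z -> cdiff g z -> cdiff (fun y => f y * g y)%C z.
Proof.
intros Hf Hg; assert (Cg := cdiff_ccontinuous _ _ Hg).
destruct Hf as (q & Hq & E); destruct Hg as (r & Hr & E').
exists (fun y => q y * g y + f z * r y)%C; split.
- apply ccontinuous_plus; apply ccontinuous_mult; trivial; apply ccontinuous_const.
- intros y; replace (f y * g y - f z * g z)%C
    with ((f y - f z) * g y + f z * (g y - g z))%C by ring.
  rewrite E, E'; ring.
Qed.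

Lemma cdiff_comp (f g : C -> C) (z : C) :
  cdiff g z -> cdiff f (g z) -> cdiff (fun y => f (g y)) z.
Proof.
intros Hg; assert (Cg := cdiff_ccontinuous _ _ Hg); revert Hg.
intros (r & Hr & E') (q & Hq & E).
exists (fun y => q (g y) * r y)%C; split.
- apply ccontinuous_mult; trivial; now apply ccontinuous_comp.
- intros y; rewrite E, E'; ring.
Qed.

(** The equation in [cdiff] is global in y, so locality passes through [is_cderive], from which a
    global quotient is rebuilt. *)
Lemma cdiff_ext_loc (f g : C -> C) (z : C) (d : R) :
  0 < d -> (forall y, Cmod (y - z) < d -> f y = g y) -> cdiff f z -> cdiff g z.
Proof.
intros Hd E Hf; destruct (cdiff_is_cderive _ _ Hf) as [l Hl].
apply is_cderive_cdiff with l; intros eps He.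
destruct (Hl eps He) as (d' & Hd' & K).
exists (Rmin d d'); split; [now apply Rmin_glb_lt|]; intros y Hy.
rewrite <- !E.
- apply K, Rlt_le_trans with (1 := Hy), Rmin_r.
- replace (z - z)%C with (RtoC 0) by ring; now rewrite Cmod_0.
- apply Rlt_le_trans with (1 := Hy), Rmin_l.
Qed.

Lemma cdiff_inv (z : C) : z <> 0 -> cdiff Cinv z.
Proof.
intros Hz; apply is_cderive_cdiff with (- / (z * z))%C.
intros eps He; apply Cmod_gt_0 in Hz as Pz.
assert (Hc : ccontinuous (fun y => - (/ y * / z))%C z).
{ intros e Hpe.
  assert (H : ccontinuous (fun y => - RtoC 1 * (/ y * / z))%C z).
  { apply ccontinuous_mult; [apply ccontinuous_const|].
    apply ccontinuous_mult; [now apply ccontinuous_inv|apply ccontinuous_const]. }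
  destruct (H e Hpe) as (d & Hd & K); exists d; split; trivial; intros y Hy.
  replace (- (/ y * / z) - - (/ z * / z))%C
    with (- RtoC 1 * (/ y * / z) - - RtoC 1 * (/ z * / z))%C; [now apply K|ring]. }
destruct (Hc eps He) as (d & Hd & K).
(* Radius |z| keeps y away from 0, where the formula for the difference of inverses fails. *)
exists (Rmin d (Cmod z)); split; [now apply Rmin_glb_lt|]; intros y Hy.
assert (Hy0 : y <> 0).
{ intros ->; apply (Rlt_irrefl (Cmod z)).
  replace (RtoC 0 - z)%C with (- z)%C in Hy by ring; rewrite Cmod_opp in Hy.
  apply Rlt_le_trans with (1 := Hy), Rmin_r. }
replace (/ y - / z - - / (z * z) * (y - z))%C
  with ((- (/ y * / z) - - (/ z * / z)) * (y - z))%C by (field; now split).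
rewrite Cmod_mult; apply Rmult_le_compat_r; [apply Cmod_ge_0|].
left; apply K, Rlt_le_trans with (1 := Hy), Rmin_l.
Qed.

Lemma cdiff_div (f g : C -> C) (z : C) :
  cdiff f z -> cdiff g z -> g z <> 0 -> cdiff (fun y => f y / g y)%C z.
Proof.
intros Hf Hg Hz; apply (cdiff_mult f (fun y => / g y)%C); trivial.
now apply (cdiff_comp Cinv g), cdiff_inv.
Qed.

(** * The mean value property *)

Lemma Cmod_le_abs (z : C) : Cmod z <= Rabs (Re z) + Rabs (Im z).
Proof.
destruct z as [x y]; simpl.
replace (x, y) with (RtoC x + RtoC y * Ci)%C
  by (unfold Cplus, Cmult, Ci, RtoC; simpl; f_equal; ring).
apply Rle_trans with (1 := Cmod_triangle _ _).
rewrite Cmod_mult, Cmod_Ci, !Cmod_R; lra.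
Qed.

Lemma im_le_Cmod (z : C) : Rabs (Im z) <= Cmod z.
Proof. apply Rle_trans with (2 := Rmax_Cmod z), Rmax_r. Qed.

Lemma differentiable_pt_lim_partials (f dfx : R -> R -> R) (x y dfy : R) :
  locally (x, y) (fun p : R * R => is_derive (fun z => f z (snd p)) (fst p) (dfx (fst p) (snd p))) ->
  is_derive (fun z => f x z) y dfy -> continuity_2d_pt dfx x y ->
  differentiable_pt_lim f x y (dfx x y) dfy.
Proof.
intros Hx Hy Hc; apply filterdiff_differentiable_pt_lim.
apply filterdiff_ext_lin with (fun u : R * R => plus (scal (fst u) (dfx x y)) (scal (snd u) dfy)).
- apply is_derive_filterdiff; [exact Hx|exact Hy|now apply continuity_2d_pt_filterlim].
- intros [u v]; reflexivity.
Qed.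

(** The Cauchy-Riemann equations: the single number l yields all four partial derivatives. *)
Lemma is_cderive_differentiable (F : C -> C) (x y : R) (l : C) :
  is_cderive F (x, y) l ->
  differentiable_pt_lim (fun u v => Re (F (u, v))) x y (Re l) (- Im l) /\
  differentiable_pt_lim (fun u v => Im (F (u, v))) x y (Im l) (Re l).
Proof.
intros H.
assert (K : forall eps : posreal, locally_2d (fun u v =>
  Cmod (F (u, v) - F (x, y) - l * ((u, v) - (x, y))) <=
  eps * Rmax (Rabs (u - x)) (Rabs (v - y))) x y).
(* Halving eps pays for the modulus being bounded by twice the maximum of the two coordinates. *)
{ intros eps; destruct (H (eps / 2)) as (d & Hd & K);
    [apply Rdiv_lt_0_compat; [apply cond_pos|lra]|].
  assert (Hd2 : 0 < d / 2) by lra.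
  exists (mkposreal _ Hd2); simpl; intros u v Hu Hv.
  assert (E : ((u, v) - (x, y))%C = (u - x, v - y)) by reflexivity.
  assert (L := Cmod_le_abs ((u, v) - (x, y))%C); rewrite E in L at 2 3; simpl in L.
  apply Rle_trans with (1 := K (u, v) ltac:(lra)).
  assert (0 < eps) by apply cond_pos.
  generalize (Rmax_l (Rabs (u - x)) (Rabs (v - y))) (Rmax_r (Rabs (u - x)) (Rabs (v - y))).
  nra. }
split; intros eps; destruct (K eps) as [d Hd]; exists d; intros u v Hu Hv;
  refine (Rle_trans _ _ _ _ (Hd u v Hu Hv)).
- eapply Rle_trans; [right|apply re_le_Cmod]; f_equal; simpl; unfold Re, Im; ring.
- eapply Rle_trans; [right|apply im_le_Cmod]; f_equal; simpl; unfold Re, Im; ring.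
Qed.

Definition polar (r t : R) : C := (r * cos t, r * sin t).

Lemma Cmod_polar (r t : R) : Cmod (polar r t) = Rabs r.
Proof.
unfold Cmod, polar; simpl fst; simpl snd.
replace ((r * cos t) ^ 2 + (r * sin t) ^ 2) with (Rsqr r * (Rsqr (sin t) + Rsqr (cos t)))
  by (unfold Rsqr; ring).
rewrite sin2_cos2, Rmult_1_r; apply sqrt_Rsqr_abs.
Qed.

Lemma polar_differentiable (r t : R) :
  differentiable_pt_lim (fun u v => u * cos v) r t (cos t) (- r * sin t) /\
  differentiable_pt_lim (fun u v => u * sin v) r t (sin t) (r * cos t).
Proof.
split.
- apply (differentiable_pt_lim_partials (fun u v => u * cos v) (fun _ v => cos v)).
  + apply filter_forall; intros [u v]; simpl; auto_derive; trivial; ring.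
  + auto_derive; trivial; ring.
  + apply continuity_1d_2d_pt_comp; [apply continuity_cos|apply continuity_2d_pt_id2].
- apply (differentiable_pt_lim_partials (fun u v => u * sin v) (fun _ v => sin v)).
  + apply filter_forall; intros [u v]; simpl; auto_derive; trivial; ring.
  + auto_derive; trivial; ring.
  + apply continuity_1d_2d_pt_comp; [apply continuity_sin|apply continuity_2d_pt_id2].
Qed.

(* The imaginary part of [F dz / z] in polar coordinates. *)
Lemma closed_form_polar (F : C -> C) (r t : R) :
  0 < r -> cdiff F (polar r t) ->
  closed_form_at (fun r t => Im (F (polar r t)) / r) (fun r t => Re (F (polar r t))) r t.
Proof.
intros Hr HF; destruct (cdiff_is_cderive _ _ HF) as [l Hl].
destruct (is_cderive_differentiable _ _ _ _ Hl) as [HRe HIm].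
destruct (polar_differentiable r t) as [Hx Hy].
assert (DRe := differentiable_pt_lim_comp _ _ _ _ _ _ _ _ _ _ _ HRe Hx Hy).
assert (DIm := differentiable_pt_lim_comp _ _ _ _ _ _ _ _ _ _ _ HIm Hx Hy).
assert (Dr : differentiable_pt_lim (fun u _ => u) r t 1 0).
{ apply differentiable_pt_lim_proj1_0, derivable_pt_lim_id. }
assert (Dq : differentiable_pt_lim (fun u v => u * / v) (Im (F (polar r t))) r
               (/ r) (- Im (F (polar r t)) / r ^ 2)).
{ apply (differentiable_pt_lim_partials (fun u v => u * / v) (fun _ v => / v)).
  - apply filter_forall; intros [u v]; simpl; auto_derive; trivial; ring.
  - auto_derive; [lra|field; lra].
  - apply (continuity_2d_pt_inv (fun _ v => v)); [apply continuity_2d_pt_id2|lra]. }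
assert (D := differentiable_pt_lim_comp _ _ _ _ _ _ _ _ _ _ _ Dq DIm Dr).
(* The common mixed derivative is the real part of l * exp(i t), where l is the derivative of F. *)
eexists; exists (Re l * cos t - Im l * sin t); eexists; split.
- replace (Re l * cos t - Im l * sin t) with
    (/ r * (Im l * (- r * sin t) + Re l * (r * cos t)) + - Im (F (polar r t)) / r ^ 2 * 0)
    by (field; lra); exact D.
- replace (Re l * cos t - Im l * sin t) with (Re l * cos t + - Im l * sin t) by ring; exact DRe.
Qed.

Lemma continuity_2d_pt_polar (F : C -> C) (r t : R) :
  ccontinuous F (polar r t) -> continuity_2d_pt (fun r t => Re (F (polar r t))) r t.
Proof.
intros HF eps; destruct (HF eps (cond_pos eps)) as (d & Hd & K).
destruct (polar_differentiable r t) as [Hx Hy].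
assert (Cx : continuity_2d_pt (fun u v => u * cos v) r t)
  by (apply differentiable_continuity_pt; eexists; eexists; exact Hx).
assert (Cy : continuity_2d_pt (fun u v => u * sin v) r t)
  by (apply differentiable_continuity_pt; eexists; eexists; exact Hy).
assert (Hd2 : 0 < d / 2) by lra.
apply locally_2d_impl with (2 := Cx (mkposreal _ Hd2)).
apply locally_2d_impl with (2 := Cy (mkposreal _ Hd2)).
apply locally_2d_forall; intros u v Hv Hu; simpl in Hu, Hv.
apply Rle_lt_trans with (2 := K (polar u v)
  ltac:(apply Rle_lt_trans with (1 := Cmod_le_abs _); simpl; fold (u * cos v - r * cos t);
        fold (u * sin v - r * sin t); lra)).
exact (re_le_Cmod (F (polar u v) - F (polar r t))).
Qed.

(** Serves to reach the two kinds of radii that Goursat's theorem excludes: 0, where polar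
    coordinates degenerate, and the modulus of the exceptional point. *)
Lemma eq_ends_of_constant_inside (M : R -> R) (p q : R) :
  p < q -> continuity_pt M p -> continuity_pt M q ->
  (forall x y, p < x -> x <= y -> y < q -> M x = M y) -> M p = M q.
Proof.
intros Hpq Hp Hq HM.
destruct (Req_dec (M p) (M q)) as [E|N]; trivial; exfalso.
assert (He : 0 < Rabs (M p - M q) / 2) by (generalize (Rabs_pos_lt (M p - M q)); lra).
destruct (proj1 (continuity_pt_locally M p) Hp (mkposreal _ He)) as [d1 H1].
destruct (proj1 (continuity_pt_locally M q) Hq (mkposreal _ He)) as [d2 H2].
set (x := p + Rmin (d1 / 2) ((q - p) / 2)); set (y := q - Rmin (d2 / 2) ((q - p) / 2)).
assert (P1 := cond_pos d1); assert (P2 := cond_pos d2).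
assert (Hx : 0 < x - p <= d1 / 2 /\ x - p <= (q - p) / 2).
{ unfold x; generalize (Rmin_l (d1 / 2) ((q - p) / 2)) (Rmin_r (d1 / 2) ((q - p) / 2))
    (Rmin_glb_lt (d1 / 2) ((q - p) / 2) 0); lra. }
assert (Hy : 0 < q - y <= d2 / 2 /\ q - y <= (q - p) / 2).
{ unfold y; generalize (Rmin_l (d2 / 2) ((q - p) / 2)) (Rmin_r (d2 / 2) ((q - p) / 2))
    (Rmin_glb_lt (d2 / 2) ((q - p) / 2) 0); lra. }
assert (K1 : Rabs (M x - M p) < Rabs (M p - M q) / 2).
{ apply H1; apply Rabs_lt_between; simpl; unfold minus, plus, opp; simpl; lra. }
assert (K2 : Rabs (M y - M q) < Rabs (M p - M q) / 2).
{ apply H2; apply Rabs_lt_between; simpl; unfold minus, plus, opp; simpl; lra. }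
rewrite <- (HM x y) in K2 by lra.
revert K1 K2; unfold Rabs; repeat destruct Rcase_abs; lra.
Qed.

Definition circle_integral (F : C -> C) (r : R) : R :=
  RInt (fun t => Re (F (polar r t))) 0 (2 * PI).

Lemma circle_integral_0 (F : C -> C) : circle_integral F 0 = 2 * PI * Re (F (RtoC 0)).
Proof.
unfold circle_integral; rewrite (RInt_ext _ (fun _ => Re (F (RtoC 0)))).
- rewrite RInt_const; unfold scal; simpl; unfold mult; simpl; ring.
- intros t _; f_equal; f_equal; unfold polar, RtoC; f_equal; ring.
Qed.

Lemma ex_RInt_circle (F : C -> C) (r : R) :
  (forall z, Cmod z < 1 -> ccontinuous F z) -> Rabs r < 1 ->
  ex_RInt (fun t => Re (F (polar r t))) 0 (2 * PI).
Proof.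
intros HF Hr; apply (@ex_RInt_continuous R_CompleteNormedModule); intros t _.
apply (continuity_2d_pt_snd (fun r t => Re (F (polar r t)))), continuity_2d_pt_polar, HF.
now rewrite Cmod_polar.
Qed.

Lemma circle_integral_continuous (F : C -> C) (r : R) :
  (forall z, Cmod z < 1 -> ccontinuous F z) -> Rabs r < 1 ->
  continuity_pt (circle_integral F) r.
Proof.
intros HF Hr; apply continuity_pt_locally; intros eps.
assert (HPI := PI_RGT_0).
(* Integrating over an interval of length 2 PI then gives eps / 2, which leaves room for the strict
   inequality. *)
assert (He : 0 < eps / (4 * PI)) by (apply Rdiv_lt_0_compat; [apply cond_pos|lra]).
destruct (uniform_continuity_2d_1d' (fun r t => Re (F (polar r t))) 0 (2 * PI) r)
  with (mkposreal _ He) as [d Hd].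
{ intros t _; apply continuity_2d_pt_polar, HF; now rewrite Cmod_polar. }
assert (Hd' : 0 < Rmin d (1 - Rabs r)) by (apply Rmin_glb_lt; [apply cond_pos|lra]).
exists (mkposreal _ Hd'); intros s' Hs; pose (s := s' : R); fold s in Hs |- *; clearbody s.
change (Rabs (s - r) < Rmin d (1 - Rabs r)) in Hs.
assert (Hs1 := Rlt_le_trans _ _ _ Hs (Rmin_l _ _)).
assert (Hs2 := Rlt_le_trans _ _ _ Hs (Rmin_r _ _)).
assert (Hs3 : Rabs s < 1).
{ generalize (Rabs_triang (s - r) r); replace (s - r + r) with s by ring; lra. }
unfold circle_integral.
assert (E : RInt (fun t => Re (F (polar s t)) - Re (F (polar r t))) 0 (2 * PI) =
  RInt (fun t => Re (F (polar s t))) 0 (2 * PI) - RInt (fun t => Re (F (polar r t))) 0 (2 * PI)).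
{ apply (RInt_minus (V := R_CompleteNormedModule)); now apply ex_RInt_circle. }
rewrite <- E.
assert (B := RInt_near_const (fun t => Re (F (polar s t)) - Re (F (polar r t))) 0 (2 * PI)
  0 (eps / (4 * PI))).
rewrite Rmult_0_l, Rminus_0_r, Rminus_0_r in B.
apply Rle_lt_trans with (eps / (4 * PI) * (2 * PI)).
- apply B; [lra| |].
  + apply (@ex_RInt_minus R_NormedModule); now apply ex_RInt_circle.
  + intros t Ht; rewrite Rminus_0_r; left.
    apply Rabs_lt_between in Hs1; assert (Pd := cond_pos d).
    apply (Hd t r t s); try lra; rewrite Rminus_diag, Rabs_R0; exact Pd.
- replace (eps / (4 * PI) * (2 * PI)) with (eps / 2) by (field; lra).
  generalize (cond_pos eps); lra.
Qed.

(** The annulus is the rectangle [r,s] x [0, 2 PI] in polar coordinates; its two radial sides cancel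
    by periodicity. *)
Lemma circle_integral_constant (F : C -> C) (r s : R) :
  0 < r -> r <= s -> (forall z, r <= Cmod z <= s -> cdiff F z) ->
  circle_integral F r = circle_integral F s.
Proof.
intros Hr Hs HF; assert (HPI := PI_RGT_0).
assert (G := goursat_rectangle (fun r t => Im (F (polar r t)) / r)
  (fun r t => Re (F (polar r t))) r s 0 (2 * PI) Hs ltac:(lra)).
unfold circulation in G; fold (circle_integral F r) (circle_integral F s) in G.
rewrite (RInt_ext (fun x => Im (F (polar x (2 * PI))) / x) (fun x => Im (F (polar x 0)) / x)) in G.
- enough (circle_integral F s - circle_integral F r = 0) by lra.
  rewrite <- G; [ring|]; intros x t Hx Ht; apply closed_form_polar; [lra|].
  apply HF; rewrite Cmod_polar, Rabs_pos_eq; lra.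
- intros x _; unfold polar; now rewrite cos_2PI, sin_2PI, cos_0, sin_0.
Qed.

(** Only the circle through a escapes Goursat's theorem, so the integral is constant on either side
    of the radius |a|, and its continuity joins the two pieces. *)
Lemma circle_integral_eq (F : C -> C) (a : C) (r : R) :
  (forall z, Cmod z < 1 -> ccontinuous F z) ->
  (forall z, Cmod z < 1 -> z <> a -> cdiff F z) ->
  0 < r < 1 -> circle_integral F r = 2 * PI * Re (F (RtoC 0)).
Proof.
intros HC HD Hr; rewrite <- circle_integral_0; symmetry.
assert (Hcont : forall x, 0 <= x < 1 -> continuity_pt (circle_integral F) x).
{ intros x Hx; apply circle_integral_continuous; trivial; rewrite Rabs_pos_eq; lra. }
assert (Hpiece : forall p q, 0 <= p -> p < q -> q < 1 -> (Cmod a <= p \/ q <= Cmod a) ->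
  circle_integral F p = circle_integral F q).
{ intros p q H0p Hpq Hq Ha; apply eq_ends_of_constant_inside; [lra|apply Hcont; lra..|].
  intros x y Hx Hxy Hy; apply circle_integral_constant; [lra|lra|].
  intros z Hz; apply HD; [lra|]; intros ->; lra. }
assert (Ha := Cmod_ge_0 a).
destruct (Rle_lt_dec r (Cmod a)) as [H|H]; [apply Hpiece; lra|].
destruct Ha as [Ha|Ha]; [|apply Hpiece; lra].
transitivity (circle_integral F (Cmod a)); apply Hpiece; lra.
Qed.

(** Multiplying F by the conjugate of F(0) makes the central value the real number |F(0)|^2, so the
    mean value property for real parts bounds the modulus. *)
Lemma Cmod_center_le (F : C -> C) (a : C) (r B : R) :
  (forall z, Cmod z < 1 -> ccontinuous F z) ->
  (forall z, Cmod z < 1 -> z <> a -> cdiff F z) ->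
  0 < r < 1 -> (forall z, Cmod z = r -> Cmod (F z) <= B) -> Cmod (F (RtoC 0)) <= B.
Proof.
intros HC HD Hr HB.
set (G := fun z => (Cconj (F (RtoC 0)) * F z)%C).
assert (HGC : forall z, Cmod z < 1 -> ccontinuous G z).
{ intros z Hz; apply ccontinuous_mult; [apply ccontinuous_const|now apply HC]. }
assert (E : circle_integral G r = 2 * PI * Cmod (F (RtoC 0)) ^ 2).
{ rewrite circle_integral_eq with (a := a); trivial.
  - f_equal; change (Cmod (F (RtoC 0)) ^ 2) with (Re (RtoC (Cmod (F (RtoC 0)) ^ 2))).
    rewrite Cmod2_conj; unfold G; f_equal; ring.
  - intros z Hz Hza; apply cdiff_mult; [apply cdiff_const|now apply HD]. }
assert (HPI := PI_RGT_0).
assert (P0 := Cmod_ge_0 (F (RtoC 0))).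
assert (L : circle_integral G r <= RInt (fun _ => Cmod (F (RtoC 0)) * B) 0 (2 * PI)).
{ apply RInt_le; [lra| |apply ex_RInt_const|].
  - apply ex_RInt_circle; trivial; rewrite Rabs_pos_eq; lra.
  - intros t _; apply Rle_trans with (1 := Rle_abs _), Rle_trans with (1 := re_le_Cmod _).
    unfold G; rewrite Cmod_mult, Cmod_conj; apply Rmult_le_compat_l; trivial.
    apply HB; rewrite Cmod_polar, Rabs_pos_eq; lra. }
rewrite RInt_const in L; unfold scal in L; simpl in L; unfold mult in L; simpl in L.
rewrite E in L.
assert (HBp : 0 <= B).
{ apply Rle_trans with (2 := HB (RtoC r) ltac:(rewrite Cmod_R, Rabs_pos_eq; lra)), Cmod_ge_0. }
apply Rnot_lt_le; intros N; set (m := Cmod (F (RtoC 0))) in *.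
assert (0 < PI * (m * (m - B))) by (apply Rmult_lt_0_compat; [|apply Rmult_lt_0_compat]; lra).
lra.
Qed.

(** * The Schwarz-Pick lemma *)

(** The disk automorphism sending a to 0; its modulus is the pseudo-hyperbolic distance between a
    and z. *)
Definition mobius (a z : C) : C := ((z - a) / (1 - Cconj a * z))%C.

Lemma mobius_den_neq_0 (a z : C) : Cmod a < 1 -> Cmod z < 1 -> (1 - Cconj a * z)%C <> 0.
Proof.
intros Ha Hz E; assert (H : Cmod (Cconj a * z) = 1).
{ replace (Cconj a * z)%C with (1 - (1 - Cconj a * z))%C by ring; rewrite E.
  replace (1 - 0)%C with (RtoC 1) by ring; apply Cmod_1. }
rewrite Cmod_mult, Cmod_conj in H.
generalize (Cmod_ge_0 a) (Cmod_ge_0 z); nra.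
Qed.

Lemma Cmod_mobius_den (a z : C) :
  Cmod (1 - Cconj a * z) ^ 2 - Cmod (z - a) ^ 2 = (1 - Cmod a ^ 2) * (1 - Cmod z ^ 2).
Proof. rewrite !Cmod2_alt; destruct a, z; simpl; ring. Qed.

Lemma mobius_Cmod2 (a z : C) : Cmod a < 1 -> Cmod z < 1 ->
  1 - Cmod (mobius a z) ^ 2 =
  (1 - Cmod a ^ 2) * (1 - Cmod z ^ 2) / Cmod (1 - Cconj a * z) ^ 2.
Proof.
intros Ha Hz; assert (N := mobius_den_neq_0 a z Ha Hz).
unfold mobius; rewrite Cmod_div by exact N.
rewrite <- Cmod_mobius_den; apply Cmod_gt_0 in N; field; lra.
Qed.

Lemma Cmod_mobius_lt_1 (a z : C) : Cmod a < 1 -> Cmod z < 1 -> Cmod (mobius a z) < 1.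
Proof.
intros Ha Hz; assert (N := mobius_den_neq_0 a z Ha Hz); apply Cmod_gt_0 in N.
assert (H : 0 < 1 - Cmod (mobius a z) ^ 2).
{ rewrite mobius_Cmod2 by trivial; generalize (Cmod_ge_0 a) (Cmod_ge_0 z); intros.
  apply Rdiv_lt_0_compat; [apply Rmult_lt_0_compat; nra|nra]. }
generalize (Cmod_ge_0 (mobius a z)); nra.
Qed.

Lemma mobius_0_r (a : C) : mobius a 0 = (- a)%C.
Proof. unfold mobius; field; apply C1_nz. Qed.

Lemma mobius_diag (a : C) : mobius a a = 0.
Proof. unfold mobius, Cdiv; ring. Qed.

Lemma mobius_eq_0 (a z : C) : Cmod a < 1 -> Cmod z < 1 -> mobius a z = 0 -> z = a.
Proof.
intros Ha Hz E; assert (N := mobius_den_neq_0 a z Ha Hz).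
replace z with (mobius a z * (1 - Cconj a * z) + a)%C by (unfold mobius; field; exact N).
rewrite E; ring.
Qed.

Lemma mobius_inv (a z : C) : Cmod a < 1 -> Cmod z < 1 -> mobius (- a) (mobius a z) = z.
Proof.
intros Ha Hz; assert (N := mobius_den_neq_0 a z Ha Hz).
assert (Na := mobius_den_neq_0 a a Ha Ha).
unfold mobius; rewrite Copp_conj; field; split; [exact N|].
replace (1 - Cconj a * z - - Cconj a * (z - a))%C with (1 - Cconj a * a)%C by ring; exact Na.
Qed.

Lemma cdiff_mobius (a z : C) : Cmod a < 1 -> Cmod z < 1 -> cdiff (mobius a) z.
Proof.
intros Ha Hz; apply cdiff_div; [| |now apply mobius_den_neq_0].
- apply cdiff_plus; [apply cdiff_id|apply cdiff_const].
- apply cdiff_ext_loc with (f := fun y => (1 + - Cconj a * y)%C) (d := 1); [lra| |].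
  + intros y _; ring.
  + apply cdiff_plus; [apply cdiff_const|]; apply cdiff_mult; [apply cdiff_const|apply cdiff_id].
Qed.

(** [Cmod_center_le] bounds only the value at the center, so K(z) = h(z)/z is precomposed with the
    Möbius map taking 0 to z0. This moves the exceptional point to -z0. Circles near the unit circle
    are mapped near it, where |K| hardly exceeds 1. *)
Lemma schwarz_lemma (h : C -> C) (z0 : C) :
  (forall z, Cmod z < 1 -> Cmod (h z) < 1) -> (forall z, Cmod z < 1 -> cdiff h z) ->
  h (RtoC 0) = 0 -> Cmod z0 < 1 -> Cmod (h z0) <= Cmod z0.
Proof.
intros Hh Hd H0 Hz0.
assert (L0 : Cmod 0 < 1) by (rewrite Cmod_0; lra).
destruct (cdiff_is_cderive h 0 (Hd _ L0)) as [l Hl].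
set (K := fun y => if Ceq_dec y 0 then l else ((h y - h (RtoC 0)) / (y - 0))%C).
assert (KC0 : ccontinuous K 0) by exact (is_cderive_quotient _ _ _ Hl).
assert (KE : forall z : C, z <> 0 -> K z = (h z / z)%C).
{ intros z Hz; unfold K; destruct (Ceq_dec z 0) as [E|_]; [now elim Hz|].
  rewrite H0; unfold Cdiv; f_equal; [|f_equal]; ring. }
assert (KD : forall z : C, Cmod z < 1 -> z <> 0 -> cdiff K z).
{ intros z Hz Hz0'; apply cdiff_ext_loc with (f := fun y => (h y / y)%C) (d := Cmod z).
  - now apply Cmod_gt_0.
  - intros y Hy; symmetry; apply KE; intros ->.
    replace (0 - z)%C with (- z)%C in Hy by ring; rewrite Cmod_opp in Hy; lra.
  - apply cdiff_div; [now apply Hd|apply cdiff_id|exact Hz0']. }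
destruct (Ceq_dec z0 0) as [->|Nz0]; [rewrite H0; lra|].
enough (HK : Cmod (K z0) <= 1).
{ rewrite KE, Cmod_div in HK by exact Nz0; apply Cmod_gt_0 in Nz0.
  apply Rle_div_l in HK; lra. }
apply Rnot_lt_le; intros Hk.
(* B lies strictly between 1 and |K z0|. It bounds |K| wherever |z| >= 1 / B, that is 1 - |z|^2 <=
   g. *)
set (B := (1 + Cmod (K z0)) / 2).
assert (HB : 1 < B) by (unfold B; lra).
assert (Hz0' := Cmod_ge_0 z0).
set (m := (1 - Cmod z0) ^ 2).
assert (Hm : 0 < m) by (unfold m; nra).
set (g := 1 - / B ^ 2).
assert (Hg : 0 < g < 1).
{ unfold g; assert (0 < / B ^ 2) by (apply Rinv_0_lt_compat; nra).
  assert (/ B ^ 2 < / 1) by (apply Rinv_lt_contravar; nra). lra. }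
(* Chosen so that 1 - r^2 <= 2 (1 - r) <= g * m, where m bounds from below the squared denominator
   of the Möbius map; the / 2 keeps r positive. *)
set (r := 1 - Rmin (/ 2) (g * m / 2)).
assert (Hr : 0 < r < 1 /\ 1 - r <= g * m / 2).
{ unfold r; generalize (Rmin_l (/ 2) (g * m / 2)) (Rmin_r (/ 2) (g * m / 2))
    (Rmin_glb_lt (/ 2) (g * m / 2) 0); nra. }
destruct Hr as [Hr Hrg].
assert (Ha : Cmod (- z0) < 1) by now rewrite Cmod_opp.
set (F := fun z => K (mobius (- z0) z)).
assert (HF : Cmod (F (RtoC 0)) <= B).
{ apply Cmod_center_le with (a := (- z0)%C) (r := r); trivial.
  - intros z Hz; apply ccontinuous_comp with (g := mobius (- z0)).
    + now apply cdiff_ccontinuous, cdiff_mobius.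
    + destruct (Ceq_dec (mobius (- z0) z) 0) as [->|N]; trivial.
      now apply cdiff_ccontinuous, KD; [apply Cmod_mobius_lt_1|].
  - intros z Hz Nz; apply cdiff_comp with (g := mobius (- z0)).
    + now apply cdiff_mobius.
    + apply KD; [now apply Cmod_mobius_lt_1|].
      intros E; apply Nz; now apply mobius_eq_0.
  - intros z Hz; assert (Hz1 : Cmod z < 1) by lra.
    assert (Hden : (1 - Cmod z0) <= Cmod (1 - Cconj (- z0) * z)).
    { assert (T := Cmod_triangle (1 - Cconj (- z0) * z) (Cconj (- z0) * z)).
      replace (1 - Cconj (- z0) * z + Cconj (- z0) * z)%C with (RtoC 1) in T by ring.
      rewrite Cmod_1, Cmod_mult, Cmod_conj, Cmod_opp in T; nra. }
    assert (E := mobius_Cmod2 (- z0) z Ha Hz1); rewrite Cmod_opp, Hz in E.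
    assert (Hden2 : m <= Cmod (1 - Cconj (- z0) * z) ^ 2) by (unfold m; apply pow_incr; lra).
    assert (U : 1 - Cmod (mobius (- z0) z) ^ 2 <= g).
    { rewrite E; apply Rle_div_l; [lra|].
      assert (A : 0 <= 1 - Cmod z0 ^ 2 <= 1) by (split; nra).
      assert (A' : 0 <= 1 - r ^ 2 <= g * m) by (split; nra).
      assert (0 <= g * (Cmod (1 - Cconj (- z0) * z) ^ 2 - m)) by (apply Rmult_le_pos; lra).
      nra. }
    assert (HB2 : / B ^ 2 <= Cmod (mobius (- z0) z) ^ 2) by (unfold g in U; lra).
    assert (HBp : / B <= Cmod (mobius (- z0) z)).
    { rewrite <- pow_inv in HB2; apply Rnot_lt_le; intros N.
      assert (P := Cmod_ge_0 (mobius (- z0) z)); nra. }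
    assert (HBi : 0 < / B) by (apply Rinv_0_lt_compat; lra).
    unfold F; rewrite KE, Cmod_div by (apply Cmod_gt_0; lra).
    apply Rle_div_l; [lra|].
    assert (Cmod (h (mobius (- z0) z)) < 1) by now apply Hh, Cmod_mobius_lt_1.
    assert (B * / B = 1) by (field; lra).
    nra. }
unfold F in HF; rewrite mobius_0_r in HF.
replace (- - z0)%C with z0 in HF by ring; unfold B in HF; lra.
Qed.

(** The Schwarz lemma applied to g recentred at a in the source and at g a in the target. *)
Lemma schwarz_pick (g : C -> C) (a b : C) :
  (forall z, Cmod z < 1 -> Cmod (g z) < 1) -> (forall z, Cmod z < 1 -> cdiff g z) ->
  Cmod a < 1 -> Cmod b < 1 -> Cmod (mobius (g a) (g b)) <= Cmod (mobius a b).
Proof.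
intros Hg Hd Ha Hb.
assert (Ha' : Cmod (- a) < 1) by now rewrite Cmod_opp.
set (h := fun z => mobius (g a) (g (mobius (- a) z))).
replace (mobius (g a) (g b)) with (h (mobius a b))
  by (unfold h; now rewrite mobius_inv).
apply schwarz_lemma; [| | |now apply Cmod_mobius_lt_1].
- intros z Hz; apply Cmod_mobius_lt_1; [now apply Hg|now apply Hg, Cmod_mobius_lt_1].
- intros z Hz; assert (Hz' := Cmod_mobius_lt_1 _ _ Ha' Hz).
  apply (cdiff_comp (fun w => mobius (g a) (g w)) (mobius (- a))); [now apply cdiff_mobius|].
  apply (cdiff_comp (mobius (g a)) g); [now apply Hd|].
  apply cdiff_mobius; now apply Hg.
- unfold h; rewrite mobius_0_r; replace (- - a)%C with a by ring; apply mobius_diag.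
Qed.

(** * Self-maps of the disk with bounded displacement *)

Lemma mobius_0_l (z : C) : mobius 0 z = z.
Proof.
unfold mobius; replace (Cconj 0) with (RtoC 0); [field; apply C1_nz|].
unfold Cconj, RtoC; simpl; now rewrite Ropp_0.
Qed.

Lemma ccontinuous_conj (z : C) : ccontinuous Cconj z.
Proof.
intros eps He; exists eps; split; trivial; intros y Hy.
now rewrite <- Cminus_conj, Cmod_conj.
Qed.

(** The conjugate of p destroys holomorphy here; continuity is what the intermediate value theorem
    will ask for. *)
Lemma ccontinuous_mobius_displacement (n : C -> C) (z : C) :
  Cmod z < 1 -> Cmod (n z) < 1 -> ccontinuous n z -> ccontinuous (fun p => mobius p (n p)) z.
Proof.
intros Hz Hnz Hn.
assert (H : ccontinuous (fun p => (n p + - RtoC 1 * p) * / (1 + - RtoC 1 * (Cconj p * n p)))%C z).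
{ apply ccontinuous_mult.
  - apply ccontinuous_plus; trivial; apply ccontinuous_mult;
      [apply ccontinuous_const|apply ccontinuous_id].
  - apply (ccontinuous_comp Cinv (fun p => 1 + - RtoC 1 * (Cconj p * n p))%C).
    + apply ccontinuous_plus; [apply ccontinuous_const|].
      apply ccontinuous_mult; [apply ccontinuous_const|].
      apply ccontinuous_mult; trivial; apply ccontinuous_conj.
    + apply ccontinuous_inv.
      replace (1 + - RtoC 1 * (Cconj z * n z))%C with (1 - Cconj z * n z)%C by ring.
      now apply mobius_den_neq_0. }
assert (E : forall p, ((n p + - RtoC 1 * p) * / (1 + - RtoC 1 * (Cconj p * n p)))%C = mobius p (n p)).
{ intros p; unfold mobius, Cdiv; f_equal; [|f_equal]; ring. }
intros eps He; destruct (H eps He) as (d & Hd & K); exists d; split; trivial.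
intros y Hy; rewrite <- !E; now apply K.
Qed.

Lemma continuity_pt_Cmod_ray (F : C -> C) (p : C) (t : R) :
  ccontinuous F (RtoC t * p)%C -> continuity_pt (fun s => Cmod (F (RtoC s * p)%C)) t.
Proof.
intros H; apply continuity_pt_locally; intros eps.
destruct (H eps (cond_pos eps)) as (d & Hd & K).
assert (Hp := Cmod_ge_0 p).
assert (Hd' : 0 < d / (Cmod p + 1)) by (apply Rdiv_lt_0_compat; lra).
exists (mkposreal _ Hd'); intros s Hs; change (Rabs (s - t) < d / (Cmod p + 1)) in Hs.
assert (B : Cmod (RtoC s * p - RtoC t * p) < d).
{ replace (RtoC s * p - RtoC t * p)%C with (RtoC (s - t) * p)%C
    by (rewrite RtoC_minus; ring).
  rewrite Cmod_mult, Cmod_R.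
  apply Rle_lt_trans with (Rabs (s - t) * (Cmod p + 1)).
  - apply Rmult_le_compat_l; [apply Rabs_pos|lra].
  - apply Rlt_div_r in Hs; lra. }
apply Rle_lt_trans with (2 := K _ B).
set (x := F (RtoC s * p)%C); set (y := F (RtoC t * p)%C).
assert (T1 := Cmod_triangle (x - y) y); assert (T2 := Cmod_triangle (- (x - y)) x).
rewrite Cmod_opp in T2.
replace (x - y + y)%C with x in T1 by ring; replace (- (x - y) + x)%C with y in T2 by ring.
apply Rabs_le_between; lra.
Qed.

(* A self-map of the disk with bounded hyperbolic displacement is Euclidean-close to the
   identity near the boundary, hence fixes the center by the mean value property. *)
Lemma bounded_displacement_fixes_center (n : C -> C) (r : R) :
  (forall z, Cmod z < 1 -> Cmod (n z) < 1) -> (forall z, Cmod z < 1 -> cdiff n z) -> r < 1 ->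
  (forall p, Cmod p < 1 -> Cmod (mobius p (n p)) <= r) -> n (RtoC 0) = 0.
Proof.
intros Hn Hd Hr1 Hdisp.
assert (Hr0 : 0 <= r).
{ apply Rle_trans with (2 := Hdisp 0 ltac:(rewrite Cmod_0; lra)), Cmod_ge_0. }
assert (HF : forall s, 0 < s < 1 -> Cmod (n (RtoC 0)) <= r * (1 - s ^ 2) / (1 - r)).
{ intros s Hs.
  replace (n (RtoC 0)) with (n (RtoC 0) + - RtoC 1 * RtoC 0)%C by ring.
  assert (HD : forall z, Cmod z < 1 -> cdiff (fun z => n z + - RtoC 1 * z)%C z).
  { intros z Hz; apply cdiff_plus; [now apply Hd|].
    apply cdiff_mult; [apply cdiff_const|apply cdiff_id]. }
  apply (Cmod_center_le (fun z => n z + - RtoC 1 * z)%C 0 s); trivial.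
  - intros z Hz; now apply cdiff_ccontinuous, HD.
  - intros z Hz _; now apply HD.
  - intros z Hz; assert (Hz1 : Cmod z < 1) by lra.
    replace (n z + - RtoC 1 * z)%C with (n z - z)%C by ring.
    apply Rle_div_r; [lra|].
    assert (N := mobius_den_neq_0 z (n z) Hz1 (Hn z Hz1)).
    assert (E : (n z - z)%C = (mobius z (n z) * (1 - Cconj z * n z))%C)
      by (unfold mobius; field; exact N).
    (* Bounds |n z - z| in terms of itself: |n z - z| <= r (1 - s^2 + |n z - z|), which can be
       solved because r < 1. *)
    assert (B : Cmod (1 - Cconj z * n z) <= 1 - s ^ 2 + Cmod (n z - z)).
    { replace (1 - Cconj z * n z)%C with (RtoC (1 - s ^ 2) + - (Cconj z * (n z - z)))%C.
      - apply Rle_trans with (1 := Cmod_triangle _ _).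
        rewrite Cmod_opp, Cmod_mult, Cmod_conj, Cmod_R, Rabs_pos_eq, Hz by nra.
        generalize (Cmod_ge_0 (n z - z)); nra.
      - rewrite RtoC_minus, <- Hz, Cmod2_conj; ring. }
    assert (D := Hdisp z Hz1).
    assert (D0 := Cmod_ge_0 (mobius z (n z))); assert (D1 := Cmod_ge_0 (1 - Cconj z * n z)).
    assert (L : Cmod (n z - z) <= r * (1 - s ^ 2 + Cmod (n z - z))).
    { rewrite E at 1; rewrite Cmod_mult; apply Rmult_le_compat; trivial. }
    lra. }
apply Cmod_eq_0; apply Rle_antisym; [|apply Cmod_ge_0].
apply Rnot_lt_le; intros Hm; set (m := Cmod (n (RtoC 0))) in *.
assert (Hq : 0 <= r / (1 - r)) by (apply Rle_mult_inv_pos; lra).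
(* On the circle of radius 1 - e the bound is r / (1 - r) * (2 e - e^2), which this choice keeps at
   most m / 2. *)
set (e := Rmin (/ 2) (m / (4 * (r / (1 - r) + 1)))).
assert (He : 0 < e <= / 2).
{ split; [|apply Rmin_l]; apply Rmin_glb_lt; [lra|apply Rdiv_lt_0_compat; lra]. }
assert (He2 : e * (r / (1 - r) + 1) <= m / 4).
{ replace (m / 4) with (m / (4 * (r / (1 - r) + 1)) * (r / (1 - r) + 1)) by (field; split; lra).
  apply Rmult_le_compat_r; [lra|apply Rmin_r]. }
specialize (HF (1 - e) ltac:(lra)).
replace (r * (1 - (1 - e) ^ 2) / (1 - r)) with (r / (1 - r) * (2 * e - e ^ 2)) in HF by (field; lra).
set (k := r / (1 - r)) in *; nra.
Qed.

(** Along the segment from 0 to p the displacement starts below r and varies continuously, so it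
    cannot exceed r without taking that value. *)
Lemma gap_displacement_fixes_center (n : C -> C) (r : R) :
  (forall z, Cmod z < 1 -> Cmod (n z) < 1) -> (forall z, Cmod z < 1 -> cdiff n z) -> r < 1 ->
  Cmod (n (RtoC 0)) < r -> (forall p, Cmod p < 1 -> Cmod (mobius p (n p)) <> r) ->
  n (RtoC 0) = 0.
Proof.
intros Hn Hd Hr Hlt Hgap; apply bounded_displacement_fixes_center with r; trivial.
intros p Hp; apply Rnot_lt_le; intros Hgt.
assert (Hray : forall t, 0 <= t <= 1 -> Cmod (RtoC t * p) < 1).
{ intros t Ht; rewrite Cmod_mult, Cmod_R, Rabs_pos_eq by lra.
  generalize (Cmod_ge_0 p); nra. }
destruct (IVT_interv (fun t => Cmod (mobius (RtoC t * p) (n (RtoC t * p)%C)) - r) 0 1)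
  as (t & Ht & E); [|lra| | |].
- intros t Ht; apply continuity_pt_minus; [|now apply continuity_pt_const; intros ? ?].
  apply (continuity_pt_Cmod_ray (fun z => mobius z (n z))).
  assert (H := Hray t Ht).
  apply ccontinuous_mobius_displacement; trivial; [now apply Hn|now apply cdiff_ccontinuous, Hd].
- replace (RtoC 0 * p)%C with (RtoC 0) by ring; rewrite mobius_0_l; lra.
- replace (RtoC 1 * p)%C with p by ring; lra.
- apply (Hgap (RtoC t * p)%C); [now apply Hray|lra].
Qed.

(** * Compactness and isometric action of SU(3) *)

(** L below is the limit superior of u along S: u is eventually below L + eta / 2 and frequently
    above L - eta / 2. A relation S takes the place of a sequence, so that no matrix has to be
    chosen for each index. *)
Lemma pigeonhole_bounded (T : Type) (u : T -> R) (B eta : R) (S : nat -> T -> Prop) :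
  (forall x, Rabs (u x) <= B) -> 0 < eta -> (forall N, exists n x, (N <= n)%nat /\ S n x) ->
  exists S' : nat -> T -> Prop,
    (forall n x, S' n x -> S n x) /\
    (forall N, exists n x, (N <= n)%nat /\ S' n x) /\
    (forall n x m y, S' n x -> S' m y -> Rabs (u x - u y) < eta).
Proof.
intros HB Heta HS.
set (E := fun r => forall N, exists n x, (N <= n)%nat /\ S n x /\ r <= u x).
destruct (completeness E) as [L [HL1 HL2]].
- exists B; intros r Hr; destruct (Hr O) as (n & x & _ & _ & H).
  specialize (HB x); apply Rabs_le_between in HB; lra.
- exists (- B); intros N; destruct (HS N) as (n & x & Hn & Hx); exists n, x; repeat split; trivial.
  specialize (HB x); apply Rabs_le_between in HB; lra.
- assert (Hup : exists N, forall n x, (N <= n)%nat -> S n x -> u x < L + eta / 2).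
  { apply NNPP; intros H.
    assert (L + eta / 2 <= L); [|lra].
    apply HL1; intros N; apply NNPP; intros HN; apply H; exists N; intros n x Hn Hx.
    apply Rnot_le_lt; intros Hle; apply HN; now exists n, x. }
  destruct Hup as [N0 Hup].
  exists (fun n x => S n x /\ (N0 <= n)%nat /\ L - eta / 2 < u x); split; [tauto|split].
  + intros N.
    assert (Hr : exists r, E r /\ L - eta / 2 < r).
    { apply NNPP; intros H; assert (L <= L - eta / 2); [|lra].
      apply HL2; intros r Hr; apply Rnot_lt_le; intros Hlt; apply H; now exists r. }
    destruct Hr as (r & Hr & Hlt).
    destruct (Hr (max N N0)) as (n & x & Hn & Hx & Hux).
    exists n, x; repeat split; trivial; [lia|lia|lra].
  + intros n x m y (Sx & Nx & Hx) (Sy & Ny & Hy).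
    specialize (Hup n x Nx Sx) as Ux; specialize (Hup m y Ny Sy) as Uy.
    apply Rabs_lt_between; lra.
Qed.

(** The family is thinned once per function and keeps unbounded indices, which is what allows j < k
    at the end. *)
Lemma pigeonhole_bounded_list (T : Type) (us : list (T -> R)) (B eta : R) (S : nat -> T -> Prop) :
  (forall u, In u us -> forall x, Rabs (u x) <= B) -> 0 < eta ->
  (forall N, exists n x, (N <= n)%nat /\ S n x) ->
  exists j k x y, (j < k)%nat /\ S j x /\ S k y /\
    forall u, In u us -> Rabs (u x - u y) < eta.
Proof.
intros HB Heta; revert S; induction us as [|u us IH]; intros S HS.
- destruct (HS O) as (j & x & _ & Hx); destruct (HS (Datatypes.S j)) as (k & y & Hk & Hy).
  exists j, k, x, y; repeat split; trivial; intros u [].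
- destruct (pigeonhole_bounded T u B eta S) as (S' & H1 & H2 & H3); trivial.
  { apply HB; now left. }
  destruct (IH (fun u Hu => HB u (or_intror Hu)) S' H2) as (j & k & x & y & Hjk & Sx & Sy & H).
  exists j, k, x, y; repeat split; auto.
  intros v [<-|Hv]; [now apply H3 with j k|now apply H].
Qed.

(** * The Hermitian norm on C^3 and total boundedness of SU(3) *)

Definition coord (v : C3) (i : nat) : C := coeff_mat (RtoC 0) v i 0.
Definition entry (A : SU3) (i j : nat) : C := coeff_mat (RtoC 0) (SU3_mat A) i j.

Lemma coord_scal (c : C) (v : C3) (i : nat) :
  (i < 3)%nat -> coord (C3_scal c v) i = (c * coord v i)%C.
Proof. intros Hi; unfold coord, C3_scal; rewrite coeff_mat_bij by lia; reflexivity. Qed.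

Lemma coord_apply (A : SU3) (v : C3) (i : nat) : (i < 3)%nat ->
  coord (SU3_apply A v) i =
  (entry A i 0 * coord v 0 + entry A i 1 * coord v 1 + entry A i 2 * coord v 2)%C.
Proof.
intros Hi; unfold coord, SU3_apply, Mmult; rewrite coeff_mat_bij by lia.
simpl pred; rewrite !sum_Sn, sum_O; reflexivity.
Qed.

Lemma entry_orthonormal (A : SU3) (i j : nat) : (i < 3)%nat -> (j < 3)%nat ->
  (Cconj (entry A 0 i) * entry A 0 j + Cconj (entry A 1 i) * entry A 1 j
   + Cconj (entry A 2 i) * entry A 2 j)%C = if Nat.eq_dec i j then RtoC 1 else RtoC 0.
Proof.
intros Hi Hj.
assert (H := f_equal (fun M => coeff_mat (RtoC 0) M i j) (SU3_unitary A)).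
unfold Mmult, Mone in H; rewrite !coeff_mat_bij in H by lia.
simpl pred in H; rewrite !sum_Sn, sum_O in H.
unfold conj_transpose in H.
change (@zero C_Ring) with (RtoC 0) in H.
rewrite !coeff_mat_bij in H by lia.
etransitivity; [exact H|].
now destruct i as [|[|[|i]]]; try lia; destruct j as [|[|[|j]]]; try lia.
Qed.

Definition norm2 (v : C3) : R :=
  Cmod (coord v 0) ^ 2 + Cmod (coord v 1) ^ 2 + Cmod (coord v 2) ^ 2.

Lemma norm2_apply (A : SU3) (v : C3) : norm2 (SU3_apply A v) = norm2 v.
Proof.
apply RtoC_inj; unfold norm2; rewrite !RtoC_plus, !Cmod2_conj, !coord_apply by lia.
rewrite !Cplus_conj, !Cmult_conj.
assert (H := fun i j Hi Hj => entry_orthonormal A i j Hi Hj).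
assert (H00 := H 0%nat 0%nat ltac:(lia) ltac:(lia)); assert (H01 := H 0%nat 1%nat ltac:(lia) ltac:(lia)).
assert (H02 := H 0%nat 2%nat ltac:(lia) ltac:(lia)); assert (H10 := H 1%nat 0%nat ltac:(lia) ltac:(lia)).
assert (H11 := H 1%nat 1%nat ltac:(lia) ltac:(lia)); assert (H12 := H 1%nat 2%nat ltac:(lia) ltac:(lia)).
assert (H20 := H 2%nat 0%nat ltac:(lia) ltac:(lia)); assert (H21 := H 2%nat 1%nat ltac:(lia) ltac:(lia)).
assert (H22 := H 2%nat 2%nat ltac:(lia) ltac:(lia)); simpl in *; clear H.
set (x := coord v 0) in *; set (y := coord v 1) in *; set (z := coord v 2) in *.
(* The nine Kronecker constants are then replaced, in this order, by the matching column products;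
   [at 1] picks the first constant still present. *)
transitivity (Cconj x * x * RtoC 1 + Cconj x * y * RtoC 0 + Cconj x * z * RtoC 0
  + Cconj y * x * RtoC 0 + Cconj y * y * RtoC 1 + Cconj y * z * RtoC 0
  + Cconj z * x * RtoC 0 + Cconj z * y * RtoC 0 + Cconj z * z * RtoC 1)%C; [|ring].
rewrite <- H00 at 1; rewrite <- H01 at 1; rewrite <- H02 at 1; rewrite <- H10 at 1.
rewrite <- H11 at 1; rewrite <- H12 at 1; rewrite <- H20 at 1; rewrite <- H21 at 1.
rewrite <- H22 at 1; ring.
Qed.

Lemma Cmod_coord_le (v : C3) (i : nat) : (i < 3)%nat -> Cmod (coord v i) ^ 2 <= norm2 v.
Proof.
intros Hi; unfold norm2.
generalize (pow2_ge_0 (Cmod (coord v 0))) (pow2_ge_0 (Cmod (coord v 1)))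
  (pow2_ge_0 (Cmod (coord v 2))).
destruct i as [|[|[|i]]]; try lia; lra.
Qed.

Lemma Cmod_entry_le_1 (A : SU3) (i j : nat) :
  (i < 3)%nat -> (j < 3)%nat -> Cmod (entry A i j) <= 1.
Proof.
intros Hi Hj; assert (H := entry_orthonormal A j j Hj Hj).
destruct (Nat.eq_dec j j) as [_|N]; [|now elim N].
rewrite !(Cmult_comm (Cconj _)), <- !Cmod2_conj, <- !RtoC_plus in H.
apply RtoC_inj in H.
assert (K : Cmod (entry A i j) ^ 2 <= 1).
{ generalize (pow2_ge_0 (Cmod (entry A 0 j))) (pow2_ge_0 (Cmod (entry A 1 j)))
    (pow2_ge_0 (Cmod (entry A 2 j))).
  destruct i as [|[|[|i]]]; try lia; lra. }
generalize (Cmod_ge_0 (entry A i j)); intros; nra.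
Qed.

Definition C3_sub (u v : C3) : C3 :=
  mk_matrix 3 1 (fun i j => (coeff_mat (RtoC 0) u i j - coeff_mat (RtoC 0) v i j)%C).

Lemma coord_sub (u v : C3) (i : nat) :
  (i < 3)%nat -> coord (C3_sub u v) i = (coord u i - coord v i)%C.
Proof. intros Hi; unfold coord, C3_sub; rewrite coeff_mat_bij by lia; reflexivity. Qed.

Lemma SU3_apply_sub (A : SU3) (u v : C3) :
  SU3_apply A (C3_sub u v) = C3_sub (SU3_apply A u) (SU3_apply A v).
Proof.
apply C3_ext; intros i Hi; fold (coord (SU3_apply A (C3_sub u v)) i).
fold (coord (C3_sub (SU3_apply A u) (SU3_apply A v)) i).
rewrite coord_sub, !coord_apply, !coord_sub by lia; ring.
Qed.

Lemma norm2_scal (c : C) (v : C3) : norm2 (C3_scal c v) = Cmod c ^ 2 * norm2 v.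
Proof. unfold norm2; rewrite !coord_scal, !Cmod_mult by lia; ring. Qed.

(** The 9 is a factor 3 from Cauchy-Schwarz in each row, times three rows. *)
Lemma norm2_apply_diff (A B : SU3) (v : C3) (eta : R) : 0 <= eta ->
  (forall i j, (i < 3)%nat -> (j < 3)%nat -> Cmod (entry A i j - entry B i j) <= eta) ->
  norm2 (C3_sub (SU3_apply A v) (SU3_apply B v)) <= 9 * eta ^ 2 * norm2 v.
Proof.
intros Heta HAB.
assert (H : forall i, (i < 3)%nat ->
  Cmod (coord (SU3_apply A v) i - coord (SU3_apply B v) i) ^ 2 <= 3 * eta ^ 2 * norm2 v).
{ intros i Hi; rewrite !coord_apply by trivial.
  set (x := coord v 0); set (y := coord v 1); set (z := coord v 2).
  replace (entry A i 0 * x + entry A i 1 * y + entry A i 2 * z -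
     (entry B i 0 * x + entry B i 1 * y + entry B i 2 * z))%C
    with ((entry A i 0 - entry B i 0) * x + (entry A i 1 - entry B i 1) * y
          + (entry A i 2 - entry B i 2) * z)%C by ring.
  match goal with |- Cmod ?e ^ 2 <= _ => set (w := e) end.
  assert (L : Cmod w <= eta * (Cmod x + Cmod y + Cmod z)).
  { unfold w; apply Rle_trans with (1 := Cmod_triangle _ _).
    apply Rle_trans with (1 := Rplus_le_compat_r _ _ _ (Cmod_triangle _ _)).
    rewrite !Cmod_mult, !Rmult_plus_distr_l.
    repeat apply Rplus_le_compat; apply Rmult_le_compat_r; try apply Cmod_ge_0; apply HAB; lia. }
  apply Rle_trans with ((eta * (Cmod x + Cmod y + Cmod z)) ^ 2).
  { apply pow_incr; split; [apply Cmod_ge_0|exact L]. }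
  unfold norm2; fold x y z.
  replace ((eta * (Cmod x + Cmod y + Cmod z)) ^ 2)
    with (eta ^ 2 * (Cmod x + Cmod y + Cmod z) ^ 2) by ring.
  rewrite (Rmult_comm 3), Rmult_assoc; apply Rmult_le_compat_l; [apply pow2_ge_0|].
  generalize (pow2_ge_0 (Cmod x - Cmod y)) (pow2_ge_0 (Cmod x - Cmod z))
    (pow2_ge_0 (Cmod y - Cmod z)); lra. }
unfold norm2 at 1; rewrite !coord_sub by lia.
generalize (H 0%nat ltac:(lia)) (H 1%nat ltac:(lia)) (H 2%nat ltac:(lia)); lra.
Qed.

(** Compactness enters as total boundedness: the pigeonhole runs over the 18 real and imaginary
    parts of the entries, all bounded by 1. *)
Lemma close_SU3_pair (S : nat -> SU3 -> Prop) (eta : R) :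
  0 < eta -> (forall n, exists A, S n A) ->
  exists j k A B, (j < k)%nat /\ S j A /\ S k B /\
    forall i l, (i < 3)%nat -> (l < 3)%nat -> Cmod (entry A i l - entry B i l) <= eta.
Proof.
intros Heta HS.
set (idx := (0 :: 1 :: 2 :: nil)%nat).
set (us := flat_map (fun i => flat_map (fun l =>
  (fun A => Re (entry A i l)) :: (fun A => Im (entry A i l)) :: nil) idx) idx).
assert (Hidx : forall i, In i idx <-> (i < 3)%nat) by (intros i; simpl; lia).
destruct (pigeonhole_bounded_list SU3 us 1 (eta / 2) S) as (j & k & A & B & Hjk & HA & HB & H).
- intros u Hu; apply in_flat_map in Hu as (i & Hi & Hu); apply in_flat_map in Hu as (l & Hl & Hu).
  apply Hidx in Hi; apply Hidx in Hl.
  destruct Hu as [<-|[<-|[]]]; intros A; apply Rle_trans with (2 := Cmod_entry_le_1 A i l Hi Hl);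
    [apply re_le_Cmod|apply im_le_Cmod].
- lra.
- intros N; destruct (HS N) as [A HA]; now exists N, A.
- exists j, k, A, B; repeat split; trivial; intros i l Hi Hl.
  apply Hidx in Hi; apply Hidx in Hl.
  apply Rle_trans with (1 := Cmod_le_abs _).
  assert (KR : Rabs (Re (entry A i l) - Re (entry B i l)) < eta / 2).
  { apply (H (fun A => Re (entry A i l))); apply in_flat_map; exists i; split; trivial.
    apply in_flat_map; exists l; split; trivial; now left. }
  assert (KI : Rabs (Im (entry A i l) - Im (entry B i l)) < eta / 2).
  { apply (H (fun A => Im (entry A i l))); apply in_flat_map; exists i; split; trivial.
    apply in_flat_map; exists l; split; trivial; right; now left. }
  change (Re (entry A i l - entry B i l)) with (Re (entry A i l) - Re (entry B i l)).
  change (Im (entry A i l - entry B i l)) with (Im (entry A i l) - Im (entry B i l)).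
  lra.
Qed.

(** * Projective charts and immersions *)

Lemma C3_scal_1 (v : C3) : C3_scal (RtoC 1) v = v.
Proof.
apply C3_ext; intros i Hi; fold (coord (C3_scal (RtoC 1) v) i).
rewrite coord_scal by trivial; unfold coord; ring.
Qed.

(** Equal lines give A M u = B M (c v) for some scalar c, hence A M (u - c v) = (B - A) M (c v).
    Unitarity of A and M removes them from the norms, so the bound does not depend on M. *)
Lemma affine_point_close (i : chart) (w0 w1 : C2) (A B M : SU3) (eta : R) :
  let V := sqrt (norm2 (homogeneous_coords i w0)) in
  SU3_act A (SU3_act M (affine_point i w1)) = SU3_act B (SU3_act M (affine_point i w0)) ->
  0 <= eta -> 3 * eta * V <= / 2 ->
  (forall k l, (k < 3)%nat -> (l < 3)%nat -> Cmod (entry A k l - entry B k l) <= eta) ->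
  Cmod (fst w1 - fst w0) + Cmod (snd w1 - snd w0) <= 12 * eta * V * (1 + V).
Proof.
intros V E Heta Hsmall HAB.
set (u := homogeneous_coords i w1); set (v := homogeneous_coords i w0) in *.
assert (HV : V ^ 2 = norm2 v).
{ unfold V; apply pow2_sqrt; unfold norm2; fold v.
  generalize (pow2_ge_0 (Cmod (coord v 0))) (pow2_ge_0 (Cmod (coord v 1)))
    (pow2_ge_0 (Cmod (coord v 2))); lra. }
assert (HV0 : 0 <= V) by apply sqrt_pos.
assert (Hin : SU3_act A (SU3_act M (affine_point i w1)) (SU3_apply A (SU3_apply M u))).
{ exists (SU3_apply M u); split; trivial; exists u; split; trivial.
  exists (RtoC 1); symmetry; apply C3_scal_1. }
rewrite E in Hin; destruct Hin as (y & (x & (c & ->) & ->) & Ey).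
change (homogeneous_coords i w0) with v in Ey.
set (e := 3 * eta * V) in *.
assert (He : 0 <= e) by (unfold e; apply Rmult_le_pos; lra).
assert (Hc0 := Cmod_ge_0 c).
assert (HN : norm2 (C3_sub u (C3_scal c v)) <= (Cmod c * e) ^ 2).
{ rewrite <- (norm2_apply M), <- (norm2_apply A), !SU3_apply_sub, Ey.
  eapply Rle_trans; [apply norm2_apply_diff with (eta := eta); trivial|].
  - intros k l Hk Hl; rewrite <- Cmod_opp.
    replace (- (entry B k l - entry A k l))%C with (entry A k l - entry B k l)%C by ring.
    now apply HAB.
  - rewrite norm2_apply, norm2_scal, <- HV; unfold e; right; ring. }
assert (Hk : forall k, (k < 3)%nat -> Cmod (coord u k - c * coord v k) <= Cmod c * e).
{ intros k Hk; rewrite <- coord_scal, <- coord_sub by trivial.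
  assert (L := Rle_trans _ _ _ (Cmod_coord_le _ k Hk) HN).
  apply Rsqr_incr_0_var; [unfold Rsqr; lra|now apply Rmult_le_pos]. }
(* The coordinate that the chart normalizes to 1 forces c to be close to 1. *)
assert (H1 : exists k, (k < 3)%nat /\ coord u k = RtoC 1 /\ coord v k = RtoC 1).
{ destruct i; [exists 0%nat|exists 1%nat|exists 2%nat]; repeat split; lia. }
destruct H1 as (k1 & Hk1 & Eu & Ev).
assert (Hc := Hk k1 Hk1); rewrite Eu, Ev in Hc.
replace (RtoC 1 - c * RtoC 1)%C with (RtoC 1 - c)%C in Hc by ring.
(* From |1 - c| <= |c| e and e <= 1/2. *)
assert (Hc2 : Cmod c <= 2).
{ assert (T := Cmod_triangle (RtoC 1) (- (RtoC 1 - c))).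
  rewrite Cmod_opp, Cmod_1 in T; replace (RtoC 1 + - (RtoC 1 - c))%C with c in T by ring; nra. }
assert (Hcoord : forall k, (k < 3)%nat -> Cmod (coord u k - coord v k) <= 2 * e * (1 + V)).
{ intros k Hk3.
  replace (coord u k - coord v k)%C
    with ((coord u k - c * coord v k) + - ((RtoC 1 - c) * coord v k))%C by ring.
  apply Rle_trans with (1 := Cmod_triangle _ _); rewrite Cmod_opp, Cmod_mult.
  assert (Lv : Cmod (coord v k) <= V).
  { apply Rsqr_incr_0_var; trivial; unfold Rsqr.
    assert (L := Cmod_coord_le v k Hk3); lra. }
  specialize (Hk k Hk3).
  assert (Cmod c * e <= 2 * e) by nra.
  assert (Cmod (RtoC 1 - c) * Cmod (coord v k) <= (2 * e) * V).
  { apply Rmult_le_compat; try apply Cmod_ge_0; lra. }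
  lra. }
replace (12 * eta * V * (1 + V)) with (2 * e * (1 + V) + 2 * e * (1 + V)) by (unfold e; ring).
apply Rplus_le_compat; destruct i;
  solve [exact (Hcoord 0%nat ltac:(lia))|exact (Hcoord 1%nat ltac:(lia))
        |exact (Hcoord 2%nat ltac:(lia))].
Qed.

(** * Local expansion by an immersion *)

Lemma quadratic_form_coercive (E F G : R) :
  (forall a b, 0 <= E * a ^ 2 + 2 * F * (a * b) + G * b ^ 2) ->
  (forall a b, E * a ^ 2 + 2 * F * (a * b) + G * b ^ 2 = 0 -> a = 0 /\ b = 0) ->
  exists c, 0 < c /\ forall a b, c * (a ^ 2 + b ^ 2) <= E * a ^ 2 + 2 * F * (a * b) + G * b ^ 2.
Proof.
intros Hpos Hdef.
assert (HE : 0 < E).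
{ destruct (Hpos 1 0) as [H|H]; [lra|]; destruct (Hdef 1 0); lra. }
assert (HG : 0 < G).
{ destruct (Hpos 0 1) as [H|H]; [lra|]; destruct (Hdef 0 1); lra. }
assert (HD : 0 < E * G - F ^ 2).
(* At (-F, E) the form takes the value E (E G - F^2). *)
{ destruct (Hpos (- F) E) as [H|H]; [nra|]; destruct (Hdef (- F) E); lra. }
(* Determinant over trace, a lower bound for the smaller eigenvalue; it comes from completing the
   square in both variables and adding. *)
exists ((E * G - F ^ 2) / (E + G)); split; [apply Rdiv_lt_0_compat; lra|]; intros a b.
set (q := E * a ^ 2 + 2 * F * (a * b) + G * b ^ 2).
replace ((E * G - F ^ 2) / (E + G) * (a ^ 2 + b ^ 2))
  with ((E * G - F ^ 2) * (a ^ 2 + b ^ 2) / (E + G)) by (field; lra).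
apply Rle_div_l; [lra|].
assert (E * q = (E * a + F * b) ^ 2 + (E * G - F ^ 2) * b ^ 2) by (unfold q; ring).
assert (G * q = (G * b + F * a) ^ 2 + (E * G - F ^ 2) * a ^ 2) by (unfold q; ring).
generalize (pow2_ge_0 (E * a + F * b)) (pow2_ge_0 (G * b + F * a)); lra.
Qed.

Lemma smooth_differentiable (h : C -> R) (z : C) :
  locally (T := C_UniformSpace) z (smooth_at h) ->
  differentiable_pt_lim (fun x y => h (x, y)) (fst z) (snd z) (partial_x h z) (partial_y h z).
Proof.
intros H; destruct z as [x y].
assert (H0 := locally_singleton _ _ H 1%nat); simpl in H0.
destruct H0 as (_ & _ & Hy & (Hc & _) & _).
apply (differentiable_pt_lim_partials _ (fun u v => Derive (fun t => h (t, v)) u)); trivial.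
- revert H; apply filter_imp; intros [u v] Huv; specialize (Huv 1%nat); simpl in Huv.
  destruct Huv as (_ & Hx & _); simpl; now apply Derive_correct.
- now apply Derive_correct.
Qed.

(** An injective differential is bounded below, and the first-order error is a small fraction of
    that bound near z. The lemma converts closeness in the chart into closeness in the disk. *)
Lemma immersion_lower_bound (U : C -> Prop) (f : C -> CP2) (z : C) (i : chart) (w : C -> C2) :
  immersive U f -> U z -> chart_expression f z i w ->
  exists c d, 0 < c /\ 0 < d /\ forall y, Cmod (y - z) < d ->
    f y = affine_point i (w y) /\
    c * Cmod (y - z) <= Cmod (fst (w y) - fst (w z)) + Cmod (snd (w y) - snd (w z)).
Proof.
intros Himm Hz Hw; assert (Hinj := Himm z i w Hz Hw).
assert (Hs : locally (T := C_UniformSpace) z (smooth2_at w))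
  by (revert Hw; unfold chart_expression; apply filter_imp; tauto).
assert (D1 : locally (T := C_UniformSpace) z (smooth_at (fun u => Re (fst (w u)))))
  by (revert Hs; apply filter_imp; intros ? (? & ? & ? & ?); trivial).
assert (D2 : locally (T := C_UniformSpace) z (smooth_at (fun u => Im (fst (w u)))))
  by (revert Hs; apply filter_imp; intros ? (? & ? & ? & ?); trivial).
assert (D3 : locally (T := C_UniformSpace) z (smooth_at (fun u => Re (snd (w u)))))
  by (revert Hs; apply filter_imp; intros ? (? & ? & ? & ?); trivial).
assert (D4 : locally (T := C_UniformSpace) z (smooth_at (fun u => Im (snd (w u)))))
  by (revert Hs; apply filter_imp; intros ? (? & ? & ? & ?); trivial).
apply smooth_differentiable in D1, D2, D3, D4.
unfold dx, dy, componentwise in Hinj; simpl fst in Hinj; simpl snd in Hinj.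
set (x1 := partial_x (fun u => Re (fst (w u))) z) in *.
set (x2 := partial_x (fun u => Im (fst (w u))) z) in *.
set (x3 := partial_x (fun u => Re (snd (w u))) z) in *.
set (x4 := partial_x (fun u => Im (snd (w u))) z) in *.
set (y1 := partial_y (fun u => Re (fst (w u))) z) in *.
set (y2 := partial_y (fun u => Im (fst (w u))) z) in *.
set (y3 := partial_y (fun u => Re (snd (w u))) z) in *.
set (y4 := partial_y (fun u => Im (snd (w u))) z) in *.
(* The quadratic form of the Gram matrix of the two columns of the differential. *)
assert (Hq : forall a b, (x1 ^ 2 + x2 ^ 2 + x3 ^ 2 + x4 ^ 2) * a ^ 2
    + 2 * (x1 * y1 + x2 * y2 + x3 * y3 + x4 * y4) * (a * b)
    + (y1 ^ 2 + y2 ^ 2 + y3 ^ 2 + y4 ^ 2) * b ^ 2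
  = (x1 * a + y1 * b) ^ 2 + (x2 * a + y2 * b) ^ 2 + (x3 * a + y3 * b) ^ 2 + (x4 * a + y4 * b) ^ 2)
  by (intros; ring).
destruct (quadratic_form_coercive (x1 ^ 2 + x2 ^ 2 + x3 ^ 2 + x4 ^ 2)
  (x1 * y1 + x2 * y2 + x3 * y3 + x4 * y4) (y1 ^ 2 + y2 ^ 2 + y3 ^ 2 + y4 ^ 2)) as (c & Hc & Hlow).
- intros a b; rewrite Hq.
  generalize (pow2_ge_0 (x1 * a + y1 * b)) (pow2_ge_0 (x2 * a + y2 * b))
    (pow2_ge_0 (x3 * a + y3 * b)) (pow2_ge_0 (x4 * a + y4 * b)); lra.
- intros a b; rewrite Hq; intros H0.
  generalize (pow2_ge_0 (x1 * a + y1 * b)) (pow2_ge_0 (x2 * a + y2 * b))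
    (pow2_ge_0 (x3 * a + y3 * b)) (pow2_ge_0 (x4 * a + y4 * b)); intros P1 P2 P3 P4.
  assert (E1 : x1 * a + y1 * b = 0) by nra; assert (E2 : x2 * a + y2 * b = 0) by nra.
  assert (E3 : x3 * a + y3 * b = 0) by nra; assert (E4 : x4 * a + y4 * b = 0) by nra.
  apply Hinj; unfold Cplus, Cmult, RtoC; simpl; f_equal; lra.
- set (s := sqrt c).
  assert (Hs0 : 0 < s) by now apply sqrt_lt_R0.
  assert (Hsc : s * s = c) by (apply sqrt_sqrt; lra).
  (* Four components with error s / 4 * m give s * m <= 2 (S + s / 4 * m), hence S >= s / 4 * m. *)
  assert (He : 0 < s / 4) by lra.
  destruct (D1 (mkposreal _ He)) as [d1 K1]; destruct (D2 (mkposreal _ He)) as [d2 K2].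
  destruct (D3 (mkposreal _ He)) as [d3 K3]; destruct (D4 (mkposreal _ He)) as [d4 K4].
  destruct Hw as [d0 K0].
  set (d := Rmin (Rmin (Rmin d1 d2) (Rmin d3 d4)) d0).
  exists (s / 4), d; split; [lra|split].
  { repeat apply Rmin_glb_lt; apply cond_pos. }
  (* [chart_expression] uses the balls of [C_UniformSpace]; they contain the [Cmod] discs of the
     same radius. *)
  intros y Hy; split; [apply K0, C_NormedModule_mixin_compat1, Rlt_le_trans with (1 := Hy), Rmin_r|].
  set (a := fst y - fst z); set (b := snd y - snd z).
  assert (Ha : Rabs a <= Cmod (y - z)) by exact (re_le_Cmod (y - z)).
  assert (Hb : Rabs b <= Cmod (y - z)) by exact (im_le_Cmod (y - z)).
  assert (Hd : Rmin (Rmin d1 d2) (Rmin d3 d4) <= d1 /\ Rmin (Rmin d1 d2) (Rmin d3 d4) <= d2 /\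
               Rmin (Rmin d1 d2) (Rmin d3 d4) <= d3 /\ Rmin (Rmin d1 d2) (Rmin d3 d4) <= d4).
  { generalize (Rmin_l d1 d2) (Rmin_r d1 d2) (Rmin_l d3 d4) (Rmin_r d3 d4)
      (Rmin_l (Rmin d1 d2) (Rmin d3 d4)) (Rmin_r (Rmin d1 d2) (Rmin d3 d4)); lra. }
  assert (Hd' : d <= Rmin (Rmin d1 d2) (Rmin d3 d4)) by apply Rmin_l.
  specialize (K1 (fst y) (snd y) ltac:(fold a; lra) ltac:(fold b; lra)).
  specialize (K2 (fst y) (snd y) ltac:(fold a; lra) ltac:(fold b; lra)).
  specialize (K3 (fst y) (snd y) ltac:(fold a; lra) ltac:(fold b; lra)).
  specialize (K4 (fst y) (snd y) ltac:(fold a; lra) ltac:(fold b; lra)).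
  rewrite <- !surjective_pairing in K1, K2, K3, K4; simpl pos in K1, K2, K3, K4.
  fold a b in K1, K2, K3, K4.
  set (m := Cmod (y - z)) in *.
  assert (Hmax : s / 4 * Rmax (Rabs a) (Rabs b) <= s / 4 * m).
  { apply Rmult_le_compat_l; [lra|now apply Rmax_lub]. }
  set (S := Cmod (fst (w y) - fst (w z)) + Cmod (snd (w y) - snd (w z))).
  assert (G1 := re_le_Cmod (fst (w y) - fst (w z))); assert (G2 := im_le_Cmod (fst (w y) - fst (w z))).
  assert (G3 := re_le_Cmod (snd (w y) - snd (w z))); assert (G4 := im_le_Cmod (snd (w y) - snd (w z))).
  change (Re (fst (w y) - fst (w z))) with (Re (fst (w y)) - Re (fst (w z))) in G1.
  change (Im (fst (w y) - fst (w z))) with (Im (fst (w y)) - Im (fst (w z))) in G2.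
  change (Re (snd (w y) - snd (w z))) with (Re (snd (w y)) - Re (snd (w z))) in G3.
  change (Im (snd (w y) - snd (w z))) with (Im (snd (w y)) - Im (snd (w z))) in G4.
  assert (P1 := Cmod_ge_0 (fst (w y) - fst (w z))); assert (P2 := Cmod_ge_0 (snd (w y) - snd (w z))).
  assert (Hm0 : 0 <= m) by apply Cmod_ge_0.
  assert (Hlin : forall L X, Rabs (X - L) <= s / 4 * m -> Rabs X <= S -> L ^ 2 <= (S + s / 4 * m) ^ 2).
  { intros L X HL HX; apply Rabs_le_between in HL; apply Rabs_le_between in HX.
    apply pow_maj_Rabs, Rabs_le_between; lra. }
  assert (Q1 : (x1 * a + y1 * b) ^ 2 <= (S + s / 4 * m) ^ 2)
    by (eapply Hlin; [exact (Rle_trans _ _ _ K1 Hmax)|unfold S; lra]).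
  assert (Q2 : (x2 * a + y2 * b) ^ 2 <= (S + s / 4 * m) ^ 2)
    by (eapply Hlin; [exact (Rle_trans _ _ _ K2 Hmax)|unfold S; lra]).
  assert (Q3 : (x3 * a + y3 * b) ^ 2 <= (S + s / 4 * m) ^ 2)
    by (eapply Hlin; [exact (Rle_trans _ _ _ K3 Hmax)|unfold S; lra]).
  assert (Q4 : (x4 * a + y4 * b) ^ 2 <= (S + s / 4 * m) ^ 2)
    by (eapply Hlin; [exact (Rle_trans _ _ _ K4 Hmax)|unfold S; lra]).
  assert (Q := Hlow a b); rewrite Hq in Q.
  assert (Em : a ^ 2 + b ^ 2 = m ^ 2) by (unfold m; rewrite Cmod2_alt; reflexivity).
  rewrite Em in Q.
  assert (HS0 : 0 <= S) by (unfold S; lra).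
  assert (Hsq : (s * m) ^ 2 <= (2 * (S + s / 4 * m)) ^ 2).
  { replace ((s * m) ^ 2) with (c * m ^ 2) by (rewrite <- Hsc; ring); lra. }
  assert (0 <= s * m) by (apply Rmult_le_pos; lra).
  assert (s * m <= 2 * (S + s / 4 * m)); [|lra].
  apply Rsqr_incr_0_var; [unfold Rsqr; lra|lra].
Qed.

(** * Symmetries of a homogeneous immersion of the disk *)

Lemma automorphism_disk (g : C -> C) :
  automorphism unit_disk g ->
  exists h, (forall z, Cmod z < 1 -> Cmod (g z) < 1) /\ (forall z, Cmod z < 1 -> cdiff g z) /\
    (forall z, Cmod z < 1 -> Cmod (h z) < 1) /\ (forall z, Cmod z < 1 -> cdiff h z) /\
    (forall z, Cmod z < 1 -> h (g z) = z) /\ (forall z, Cmod z < 1 -> g (h z) = z).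
Proof.
intros (Hg & Dg & h & Hh & Dh & K1 & K2); exists h; repeat split; trivial;
  intros z Hz; apply ex_derive_cdiff; auto.
Qed.

Theorem theorem7p3 :
  ~ exists f : C -> CP2,
      conformal_minimal_lagrangian_immersion unit_disk f /\
      homogeneous unit_disk f.
Proof.
intros (f & (Hsmooth & Himm & _) & Hhom).
assert (H0 : Cmod 0 < 1) by (rewrite Cmod_0; lra).
destruct (Hsmooth (RtoC 0) H0) as (i & w & Hw).
destruct (immersion_lower_bound _ _ _ _ _ Himm H0 Hw) as (c & d & Hc & Hd & Hlow).
set (r := Rmin d 1 / 2).
assert (Hr : 0 < r <= / 2 /\ r < d).
{ unfold r; generalize (Rmin_l d 1) (Rmin_r d 1) (Rmin_glb_lt d 1 0 Hd ltac:(lra)); lra. }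
set (V := sqrt (norm2 (homogeneous_coords i (w (RtoC 0))))).
assert (HV : 0 <= V) by apply sqrt_pos.
(* The first term meets the smallness condition of [affine_point_close]; the second puts its
   conclusion below the lower bound c * r of the immersion. *)
set (eta := Rmin (/ (6 * (V + 1))) (c * r / (24 * (V + 1) ^ 2))).
assert (Heta : 0 < eta).
{ apply Rmin_glb_lt; [apply Rinv_0_lt_compat; lra|].
  apply Rdiv_lt_0_compat; [apply Rmult_lt_0_compat; lra|nra]. }
assert (He1 : 3 * eta * V <= / 2).
{ assert (eta * (6 * (V + 1)) <= 1); [|nra].
  replace 1 with (/ (6 * (V + 1)) * (6 * (V + 1))) at 2 by (field; lra).
  apply Rmult_le_compat_r; [lra|apply Rmin_l]. }
assert (He2 : 12 * eta * V * (1 + V) < c * r).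
{ assert (H : eta * (24 * (V + 1) ^ 2) <= c * r).
  { replace (c * r) with (c * r / (24 * (V + 1) ^ 2) * (24 * (V + 1) ^ 2)) by (field; lra).
    apply Rmult_le_compat_r; [nra|apply Rmin_r]. }
  assert (0 < c * r) by (apply Rmult_lt_0_compat; lra).
  assert (0 <= eta * (1 + V)) by (apply Rmult_le_pos; lra). nra. }
(* Distinct real targets for the center, so close that their pseudo-hyperbolic distances stay below
   r. *)
set (z := fun j => r / 2 * / INR (S j)).
assert (Hz : forall j, 0 < z j <= r / 2).
{ intros j; unfold z; assert (Hj : 1 <= INR (S j)).
  { rewrite S_INR; generalize (pos_INR j); lra. }
  assert (0 < / INR (S j)) by (apply Rinv_0_lt_compat; lra).
  assert (/ INR (S j) <= / 1) by (apply Rinv_le_contravar; lra).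
  split; [apply Rmult_lt_0_compat; lra|nra]. }
assert (HzD : forall j, Cmod (z j) < 1).
{ intros j; specialize (Hz j); rewrite Cmod_R, Rabs_pos_eq; lra. }
destruct (close_SU3_pair (fun j A => exists g, automorphism unit_disk g /\ g (RtoC 0) = z j /\
    forall x, Cmod x < 1 -> f (g x) = SU3_act A (f x)) eta Heta)
  as (j & k & A & B & Hjk & (gj & Aj & Zj & Fj) & (gk & Ak & Zk & Fk) & HAB).
{ intros j; destruct (Hhom (RtoC 0) (RtoC (z j)) H0 (HzD j)) as (g & (Hg & A & HA) & E).
  now exists A, g. }
destruct (automorphism_disk _ Aj) as (hj & gjD & gjC & hjD & hjC & hgj & ghj).
destruct (automorphism_disk _ Ak) as (hk & gkD & gkC & _).
set (n := fun x => hj (gk x)).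
assert (HnD : forall x, Cmod x < 1 -> Cmod (n x) < 1) by (intros x Hx; now apply hjD, gkD).
assert (Hn0 : n (RtoC 0) = 0).
{ apply gap_displacement_fixes_center with r; trivial.
  - intros x Hx; apply (cdiff_comp hj gk); [now apply gkC|now apply hjC, gkD].
  - lra.
  (* As [hj] sends z j to 0, |n 0| is the distance between the images under [hj] of z j and z k,
     which Schwarz-Pick bounds by the distance of these two points. *)
  - unfold n; rewrite Zk, <- (mobius_0_l (hj (z k))).
    rewrite <- (hgj (RtoC 0) H0), Zj.
    apply Rle_lt_trans with (1 := schwarz_pick hj _ _ hjD hjC (HzD j) (HzD k)).
    generalize (Hz j) (Hz k); intros Lj Lk; unfold mobius.
    assert (Hden : 1 - z j * z k >= / 2) by nra.
    replace (Cconj (z j)) with (RtoC (z j)) by (unfold Cconj, RtoC; simpl; now rewrite Ropp_0).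
    rewrite <- RtoC_mult, <- !RtoC_minus, <- RtoC_div, Cmod_R by lra.
    rewrite Rabs_div, (Rabs_pos_eq (1 - _)) by lra.
    apply Rlt_div_l; [lra|]; apply Rlt_le_trans with (r * / 2); [|nra].
    apply Rabs_lt_between; lra.
  - intros p Hp E.
    destruct (Hhom (RtoC 0) p H0 Hp) as (g & (Ag & M & HM) & Eg).
    destruct (automorphism_disk _ Ag) as (h & gD & gC & hD & hC & hg & gh).
    set (q := h (n p)).
    assert (Hnp := HnD p Hp).
    assert (Hq : Cmod q < 1) by now apply hD.
    assert (Egq : g q = n p) by now apply gh.
    (* Schwarz-Pick for g and for its inverse h shows that g preserves the distance from 0 to q,
       which therefore equals that from p to n p. *)
    assert (Hqr : Cmod q = r).
    { assert (L1 := schwarz_pick h p (n p) hD hC Hp Hnp).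
      assert (L2 := schwarz_pick g (RtoC 0) q gD gC H0 Hq).
      rewrite Eg, Egq, mobius_0_l in L2.
      rewrite <- Eg in L1 at 1; rewrite hg, mobius_0_l in L1 by exact H0.
      fold q in L1; lra. }
    destruct (Hlow q) as [Fq Lq].
    { replace (q - RtoC 0)%C with q by ring; lra. }
    replace (q - RtoC 0)%C with q in Lq by ring; rewrite Hqr in Lq.
    destruct (Hlow (RtoC 0)) as [F0 _].
    { replace (RtoC 0 - RtoC 0)%C with (RtoC 0) by ring; now rewrite Cmod_0. }
    (* Both sides are f at the point gj (n p) = gk p. *)
    assert (EF : SU3_act A (SU3_act M (affine_point i (w q)))
                 = SU3_act B (SU3_act M (affine_point i (w (RtoC 0))))).
    { rewrite <- Fq, <- F0, <- !HM, Egq, Eg by trivial.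
      rewrite <- Fj, <- Fk by trivial; f_equal; unfold n; apply ghj, gkD, Hp. }
    assert (L := affine_point_close _ _ _ _ _ _ eta EF (Rlt_le _ _ Heta) He1 HAB).
    fold V in L; lra. }
unfold n in Hn0; rewrite Zk in Hn0.
(* Since [hj] sends z k to 0, z k = gj 0 = z j, although j < k. *)
assert (E : RtoC (z k) = RtoC (z j)).
{ rewrite <- Zj, <- Hn0; symmetry; apply ghj, HzD. }
apply RtoC_inj in E; unfold z in E; apply Rmult_eq_reg_l in E; [|lra].
apply Rinv_eq_reg, INR_eq in E; lia.
Qed.
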